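(* Let $n\ge 1$. The map $\alpha=\mathcal{F}\circ\phi\circ\theta$, i.e. $\alpha(\pi)=\mathcal{F}(\phi(\theta(\pi)))$, is a bijection between $S_n(P)$ and $\mathcal{M}_n$ such that for every $\pi\in S_n(P)$: (1) $LRmax(\pi)$ is the weight of the first row of $\alpha(\pi)$; (2) $RLmin(\pi)$ is the weight of the last column of $\alpha(\pi)$; (3) $RLmax(\pi)$ is the number of wNE-cells of $\alpha(\pi)$; (4) $LRmin(\pi)$ is the number of nonzero cells of $\alpha(\pi)$ belonging to the main diagonal.
   Context: Permutations. A permutation $\pi=\pi_1\cdots\pi_n$ of $\{1,\dots,n\}$ contains the pattern $P$ if there are indices $i,j$ with $j>i+1$ and $\pi_i+1=\pi_j<\pi_{i+1}$; otherwise it avoids $P$. $S_n(P)$ is the set of permutations of $\{1,\dots,n\}$ avoiding $P$. An entry $\pi_i$ is an LR-maximum (LR-minimum) if it is larger (smaller) than all entries to its left, and an RL-maximum (RL-minimum) if it is larger (smaller) than all entries to its right. $LRmax(\pi)$, $LRmin(\pi)$, $RLmax(\pi)$, $RLmin(\pi)$ denote the numbers of such entries. Ascent sequences. For an integer sequence $x=x_1\cdots x_n$, $asc(x)$ is the number of $i$ with $1\le i<n$ and $x_i<x_{i+1}$. An ascent sequence of length $n$ is a sequence $x_1\cdots x_n$ with $x_1=0$ and $0\le x_i\le asc(x_1\cdots x_{i-1})+1$ for $2\le i\le n$. $\mathcal{A}_n$ is the set of these. The map $\theta:S_n(P)\to\mathcal{A}_n$. Deleting the entry $n$ from an element of $S_n(P)$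 gives an element of $S_{n-1}(P)$. For $\tau\in S_{n-1}(P)$, a site (before the first entry, between two consecutive entries, or after the last entry) is active if inserting $n$ there gives a permutation in $S_n(P)$. The active sites are labeled from right to left by $0,1,2,\dots$. Set $\theta(1)=0$ for the permutation $1\in S_1(P)$. If $n\ge2$ and $\pi\in S_n(P)$ is obtained from $\tau\in S_{n-1}(P)$ by inserting $n$ into the active site of $\tau$ labeled $x_n$, and $\theta(\tau)=x_1\cdots x_{n-1}$, then $\theta(\pi)=x_1\cdots x_{n-1}x_n$. Fishburn matrices. A Fishburn matrix is a square upper triangular matrix with nonnegative integer entries in which every row and every column contains at least one nonzero entry. The weight of a matrix, row or column is the sum of its entries. $\mathcal{M}_n$ is the set of Fishburn matrices of weight $n$. Rows are numbered from top to bottom, columns from left to right, starting at $1$. $dim(A)$ is the number of rows of $A$, and $index(A)$ is the smallest $i$ with $A_{i,dim(A)}>0$. A cell $(i,j)$ is nonzero if $A_{i,j}\ne0$. A nonzero cell $(i,j)$ is a wNE-cell if $A_{s,t}=0$ for all $(s,t)\neq(i,j)$ with $s\le i$ and $t\ge j$. Addition operation $g(A,i)$, for a Fishburn matrix $A$ and an integer $0\le i\le dim(A)$: (Add1) If $0\le i\le index(A)-1$, then $g(A,i)$ is $A$ with the entry in cell $(i+1,dim(A))$ increased by $1$. (Add2) If $i=dim(A)$, then $g(A,i)=\begin{pmatrix}A&0\\0&1\end{pmatrix}$. (Add3) If $index(A)\le i<dim(A)$, insert into $A$ a new row between rows $i$ and $i+1$ and a new column between columns $i$ and $i+1$; all new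 cells are $0$ except the rightmost cell of the new row, which is $1$. Call the result $A'$ (so the new row and column have number $i+1$ in $A'$). Let $T=\{c_1<c_2<\dots<c_\ell\}$ be the set of indices $j\ge i+1$ such that column $j$ of $A'$ contains a nonzero cell above row $i+1$ (then $c_\ell=dim(A')$), and let $c_0=i+1$. Simultaneously for all $1\le a\le i$ and $1\le b\le\ell$, move the entry of cell $(a,c_b)$ of $A'$ to cell $(a,c_{b-1})$, and fill all cells of column $dim(A')$ above row $i+1$ with zeros. The result is $g(A,i)$. The map $\phi:\mathcal{A}_n\to\mathcal{M}_n$. For $x=x_1\cdots x_n\in\mathcal{A}_n$ put $A^{(1)}=(1)$ and $A^{(k)}=g(A^{(k-1)},x_k)$ for $1<k\le n$; then $\phi(x)=A^{(n)}$. The flip $\mathcal{F}(A)$ of $A\in\mathcal{M}_n$ is the matrix obtained by transposing $A$ along the North-East diagonal: if $d=dim(A)$, then $\mathcal{F}(A)_{i,j}=A_{d+1-j,d+1-i}$. *)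

(* Defs.v *)
From mathcomp Require Import all_boot all_order all_algebra.

Set Implicit Arguments.
Unset Strict Implicit.
Unset Printing Implicit Defensive.

Local Open Scope nat_scope.

(** Permutations of {1, ..., n} are words (one-line notation), i.e. sequences
    that are rearrangements of [iota 1 n].  Positions are 0-based, entries are
    1-based. *)

Definition contains_P (pi : seq nat) : bool :=
  has (fun i => has (fun j =>
        [&& i.+1 < j, (nth 0 pi i).+1 == nth 0 pi j
          & nth 0 pi j < nth 0 pi i.+1])
      (iota 0 (size pi))) (iota 0 (size pi)).

Definition S_P (n : nat) : pred (seq nat) :=
  [pred pi | perm_eq pi (iota 1 n) & ~~ contains_P pi].

Definition LRmax (pi : seq nat) : nat :=
  count (fun i => all (fun y => y < nth 0 pi i) (take i pi))
        (iota 0 (size pi)).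

Definition LRmin (pi : seq nat) : nat :=
  count (fun i => all (fun y => nth 0 pi i < y) (take i pi))
        (iota 0 (size pi)).

Definition RLmax (pi : seq nat) : nat :=
  count (fun i => all (fun y => y < nth 0 pi i) (drop i.+1 pi))
        (iota 0 (size pi)).

Definition RLmin (pi : seq nat) : nat :=
  count (fun i => all (fun y => nth 0 pi i < y) (drop i.+1 pi))
        (iota 0 (size pi)).

(** A site of [tau] is identified with the number [k] of entries to its left,
    [0 <= k <= size tau]. *)

Definition insert_at (k x : nat) (tau : seq nat) : seq nat :=
  take k tau ++ x :: drop k tau.

(** The active sites of [tau] for the insertion of [n], listed from right to
    left, so that the label of an active site is its index in this list. *)
Definition active_sites (n : nat) (tau : seq nat) : seq nat :=
  [seq k <- rev (iota 0 (size tau).+1) | insert_at k n tau \in S_P n].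

Fixpoint theta_rec (n : nat) (pi : seq nat) : seq nat :=
  match n with
  | 0 => [::]
  | 1 => [:: 0]
  | m.+1 => let tau := rem n pi in
            rcons (theta_rec m tau) (index (index n pi) (active_sites n tau))
  end.

Definition theta (pi : seq nat) : seq nat := theta_rec (size pi) pi.

(** Square matrices of arbitrary positive dimension.  Row and column numbers
    are elements of ['I_d.+1], hence 0-based; the argument [i] of [g] below is
    still the one of the usual 1-based description (e.g. [add1 A i] increases
    the entry in the [i+1]-st row). *)

Definition sqmx : Type := {d : nat & 'M[nat]_d.+1}.
Definition Sqmx (d : nat) (A : 'M[nat]_d.+1) : sqmx :=
  existT (fun d => 'M[nat]_d.+1) d A.

Definition weight (d : nat) (A : 'M[nat]_d.+1) : nat :=
  \sum_(i < d.+1) \sum_(j < d.+1) A i j.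

Definition row_weight (d : nat) (A : 'M[nat]_d.+1) (i : 'I_d.+1) : nat :=
  \sum_(j < d.+1) A i j.

Definition col_weight (d : nat) (A : 'M[nat]_d.+1) (j : 'I_d.+1) : nat :=
  \sum_(i < d.+1) A i j.

Definition fishburn (d : nat) (A : 'M[nat]_d.+1) : bool :=
  [&& [forall i : 'I_d.+1, forall j : 'I_d.+1, (j < i) ==> (A i j == 0)],
      [forall i, exists j, A i j != 0]
    & [forall j, exists i, A i j != 0]].

Definition Mn (n : nat) : pred sqmx :=
  [pred A : sqmx | fishburn (tagged A) & weight (tagged A) == n].

Definition wNE (d : nat) (A : 'M[nat]_d.+1) (i j : 'I_d.+1) : bool :=
  (A i j != 0) &&
  [forall s : 'I_d.+1, forall t : 'I_d.+1,
     [&& s <= i, j <= t & (s, t) != (i, j)] ==> (A s t == 0)].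

Definition num_wNE (d : nat) (A : 'M[nat]_d.+1) : nat :=
  #|[set c : 'I_d.+1 * 'I_d.+1 | wNE A c.1 c.2]|.

Definition num_diag (d : nat) (A : 'M[nat]_d.+1) : nat :=
  #|[set i : 'I_d.+1 | A i i != 0]|.

(** 1-based, so that [mxindex A <= d.+1] whenever the last column of [A] is
    nonzero. *)
Definition mxindex (d : nat) (A : 'M[nat]_d.+1) : nat :=
  (find (fun s => 0 < A s ord_max) (enum 'I_d.+1)).+1.

Definition add1 (d : nat) (A : 'M[nat]_d.+1) (i : nat) : 'M[nat]_d.+1 :=
  \matrix_(s, t) (A s t + ((s == i :> nat) && (t == ord_max))).

Definition add2 (d : nat) (A : 'M[nat]_d.+1) : 'M[nat]_(d.+1 + 1) :=
  block_mx A (const_mx 0) (const_mx 0) (const_mx 1).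

(** A new row and a new column, both of 0-based index [k]; the only nonzero new
    cell is the rightmost one of the new row. *)
Definition add3_insert (d : nat) (A : 'M[nat]_d.+1) (k : 'I_d.+2) :
    'M[nat]_d.+2 :=
  \matrix_(s, t)
    match unlift k s, unlift k t with
    | Some s', Some t' => A s' t'
    | Some _, None => 0
    | None, _ => nat_of_bool (t == ord_max)
    end.

(** The columns c_1 < ... < c_l from [k] on that are nonzero above row [k]. *)
Definition add3_cols (d : nat) (A' : 'M[nat]_d.+2) (k : 'I_d.+2) :
    seq 'I_d.+2 :=
  [seq t : 'I_d.+2 <- enum 'I_d.+2 |
     (k <= t) && [exists s : 'I_d.+2, (s < k) && (A' s t != 0)]].

(** With c_0 = k, above the new row column c_(b-1) receives the content of column c_b, and
    the last column is emptied; the other columns are unchanged. *)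
Definition add3 (d : nat) (A : 'M[nat]_d.+1) (k : 'I_d.+2) : 'M[nat]_d.+2 :=
  let A' := add3_insert A k in
  let c := k :: add3_cols A' k in
  \matrix_(s, t)
    if s < k then
      if t == ord_max then 0
      else if t \in c then A' s (nth ord_max c (index t c).+1)
      else A' s t
    else A' s t.

(** Meant for [i <= dim A]; the value for larger [i] is irrelevant. *)
Definition g (A : sqmx) (i : nat) : sqmx :=
  let: existT d M := A in
  if i < mxindex M then Sqmx (add1 M i)
  else if i == d.+1 then Sqmx (add2 M)
  else Sqmx (add3 M (inord i)).

Definition phi (x : seq nat) : sqmx :=
  foldl g (Sqmx (const_mx 1 : 'M[nat]_1)) (behead x).

Definition flip (A : sqmx) : sqmx :=
  let: existT d M := A in
  Sqmx (\matrix_(i < d.+1, j < d.+1) M (rev_ord j) (rev_ord i)).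

Definition alpha (pi : seq nat) : sqmx := flip (phi (theta pi)).

(* Main.v *)
Require Import Defs.
From mathcomp Require Import all_boot all_order all_algebra.
From mathcomp Require Import zify.

(** The permutations avoiding P and the Fishburn matrices are the nodes of the
    same generating tree, and the four pairs of statistics obey the same
    recursion along that tree.

    On the permutation side, insert the largest entry [N] between [l] and [r].
    Only the pattern occurrence that uses the entry just before [N] can be new,
    so a site after an entry [a] is active exactly when [a + 1] is not to its
    right: a condition on the suffix alone.  Hence the label of the site is
    [sites_after r], and the insertion changes the activity of one site only,
    the one after [N - 1], which dies exactly when [N - 1] is left of [N].

    On the matrix side, [g A i] has index [i + 1], and its dimension exceeds
    that of [A] exactly when [i] is at least the index of [A].  The two rules
    agree under the dictionary: number of active sites = dimension + 1; label
    of the site right of the largest entry = index - 1.  That [g] makes the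
    Fishburn matrices into a tree is [g_inj] and [g_surj]: the index gives back
    the label, the weight of the row it points at separates the first addition
    rule from the two others, and each rule is reversible.

    For the third rule the point is that the rows above the new one are only
    relabelled.  If [old_cols] are the columns that are nonzero there before
    the addition and [new_cols] those that are nonzero afterwards, then the
    contents are carried along the increasing bijection between the two lists
    ([transport]).  This is visibly reversible and keeps the row sums and the
    relative position of the nonzero cells.

    LR-minima and RL-minima change only when [N] is inserted in front or at the
    end, as do the number of nonzero diagonal cells and the first row sum.  The
    two kinds of maxima need a refinement: group them by the number of active
    sites to their right.  The LR-maxima with [j + 1] sites to their right
    number the entry of row [j] in the last column, and there is an RL-maximum
    with [j + 1] sites to its right exactly when row [j] holds a wNE-cell, in
    which case there is just one.  All this is the invariant [matches], kept by
    [matches_step].  Finally the flip turns the last column into the first row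
    and the first row into the last column, and preserves the diagonal and the
    wNE-cells. *)

Set Implicit Arguments.
Unset Strict Implicit.
Unset Printing Implicit Defensive.

Local Open Scope nat_scope.

(** * Counting entries by what stands around them *)

(** The word is read as [p ++ s ++ t], and only the entries of [s] are counted.
    Keeping the context [t] makes the count additive in [s], so that the
    effect of an insertion can be located. *)
Fixpoint count_split (Q : seq nat -> nat -> seq nat -> bool)
    (p s t : seq nat) : nat :=
  if s is a :: s' then Q p a (s' ++ t) + count_split Q (rcons p a) s' t else 0.

Lemma count_split_cat Q p s1 s2 t :
  count_split Q p (s1 ++ s2) t =
  count_split Q p s1 (s2 ++ t) + count_split Q (p ++ s1) s2 t.
Proof.
elim: s1 p => [|a s1 IH] p /=; first by rewrite cats0.
by rewrite IH cat_rcons catA addnA.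
Qed.

Lemma eq_count_split Q Q' p p' s t t' :
  (forall u a v, s = u ++ a :: v ->
     Q (p ++ u) a (v ++ t) = Q' (p' ++ u) a (v ++ t')) ->
  count_split Q p s t = count_split Q' p' s t'.
Proof.
elim: s p p' => [//|a s IH] p p' H /=; congr (nat_of_bool _ + _).
  by have := H [::] a s erefl; rewrite !cats0.
by apply: IH => u b v Es; rewrite !cat_rcons; apply: (H (a :: u)); rewrite Es.
Qed.

Lemma count_split0 Q p s t :
  (forall u a v, s = u ++ a :: v -> Q (p ++ u) a (v ++ t) = false) ->
  count_split Q p s t = 0.
Proof.
move=> H; rewrite (@eq_count_split Q (fun _ _ _ => false) p p s t t) //.
by elim: s p {H} => //= a s IH p; rewrite IH.
Qed.

Lemma count_iota_split Q s :
  count (fun i => Q (take i s) (nth 0 s i) (drop i.+1 s)) (iota 0 (size s)) =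
  count_split Q [::] s [::].
Proof.
suff H p : count (fun i => Q (take i (p ++ s)) (nth 0 (p ++ s) i)
                            (drop i.+1 (p ++ s))) (iota (size p) (size s)) =
           count_split Q p s [::] by exact: (H [::]).
elim: s p => [//|a s IH] p /=.
rewrite take_size_cat // nth_cat ltnn subnn /= cats0 -cat_rcons.
by rewrite drop_size_cat ?size_rcons // -IH size_rcons.
Qed.

(** Counts refined by a key add up to the unrefined count. *)
Lemma sum_count_split (Q : seq nat -> nat -> seq nat -> bool) key m p s t :
  (forall u a v, s = u ++ a :: v -> key a (v ++ t) < m) ->
  \sum_(j < m) count_split (fun p a r => Q p a r && (key a r == j)) p s t =
  count_split Q p s t.
Proof.
elim: s p => [|a s IH] p H /=; first by rewrite big1.
rewrite big_split /= IH => [|u b v Es]; last by apply: (H (a :: u)); rewrite Es.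
congr (_ + _); have lt_km := H [::] a s erefl.
rewrite (bigD1 (Ordinal lt_km)) //= eqxx andbT big1 ?addn0 // => j.
rewrite -val_eqE /= eq_sym => /negPf ->; by rewrite andbF.
Qed.

(** * Active sites *)

(** The number of active sites strictly to the right of a site that is followed
    by [s].  Such a site stands after an entry of [s], and is active unless the
    next larger value occurs further right. *)
Fixpoint sites_after (s : seq nat) : nat :=
  if s is a :: r then (a.+1 \notin r) + sites_after r else 0.

(** Activity of the site between [l] and [r]. *)
Definition open_site (l r : seq nat) : bool :=
  (l == [::]) || ((last 0 l).+1 \notin r).

(** The site at the very end is always active. *)
Lemma sites_after_gt0 a s : 0 < sites_after (a :: s).
Proof. by elim: s a => [//|b s IH] a; apply: ltn_addl; apply: IH. Qed.

Lemma leq_sites_after l r : sites_after r <= sites_after (l ++ r).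
Proof. by elim: l => //= a l IH; rewrite (leq_trans IH) ?leq_addl. Qed.

Lemma ltn_sites_after_open a l r :
  open_site (a :: l) r -> sites_after r < sites_after (a :: l ++ r).
Proof.
rewrite /open_site -cat_cons => H; rewrite (lastI a l) cat_rcons.
by apply: leq_trans (leq_sites_after _ _); move: H => /= ->.
Qed.

(** The new entry brings one active site, the one to its right, and closes the
    site after [n] when [n] stands to its left. *)
Lemma sites_after_insert n l r : uniq (l ++ r) -> n.+1 \notin l ++ r -> n.+2 \notin r ->
  sites_after (l ++ n.+1 :: r) = (n \notin l) + sites_after (l ++ r).
Proof.
elim: l => [|a l IH] /=; first by move=> _ _ ->.
case/andP=> a_lr Ulr; rewrite inE negb_or => /andP[_ n1_lr] n2_r.
rewrite IH // inE !mem_cat !inE eqSS (eq_sym n).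
move: a_lr n1_lr; rewrite !mem_cat !negb_or => /andP[a_l _] /andP[n1_l n1_r].
case: eqVneq a_l => [->|_] /= a_l; last by rewrite addnCA.
by rewrite a_l n1_l n1_r andbF.
Qed.

(** In [a :: b :: r], if [b] exceeds [a.+1] then [a.+1] can only occur in [r];
    so membership in the whole tail expresses the gap [j > i + 1] of the
    pattern. *)
Fixpoint has_P (s : seq nat) : bool :=
  if s is a :: r then (a.+1 \in r) && (a.+1 < head 0 r) || has_P r else false.

Lemma contains_PE s : contains_P s = has_P s.
Proof.
transitivity (has (fun i => ((nth 0 s i).+1 \in drop i.+1 s) &&
                     ((nth 0 s i).+1 < head 0 (drop i.+1 s)))
                  (iota 0 (size s))); last first.
  elim: s => //= a s <-; rewrite drop0; congr (_ || _).
  by rewrite (iotaDl 1 0) has_map; apply: eq_has => i.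
apply: eq_in_has => /= i _; rewrite -nth0 nth_drop addn0.
apply/hasP/andP => [[j]|[/(nthP 0) [p p_lt Ep] lt_head]].
  rewrite mem_iota /= => lt_js /and3P[lt_ij /eqP-> ->]; split=> //.
  rewrite -(subnKC (ltnW lt_ij)) -nth_drop mem_nth // size_drop.
  by apply: ltn_sub2r (lt_js); apply: ltn_trans lt_ij lt_js.
rewrite nth_drop in Ep; rewrite size_drop in p_lt; exists (i.+1 + p).
  by rewrite mem_iota; move: p_lt => /= p_lt; lia.
rewrite Ep eqxx lt_head andbT /= -addn1 leq_add2l.
by case: p Ep {p_lt} => // Ep; rewrite addn0 in Ep; rewrite Ep ltnn in lt_head.
Qed.

(** Deleting the largest entry creates no occurrence: an occurrence that uses
    the new adjacency [a b] across the gap already occurred with the deleted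
    entry in place of [b]. *)
Lemma has_P_rem n l r : all (leq^~ n) (l ++ r) ->
  has_P (l ++ r) -> has_P (l ++ n.+1 :: r).
Proof.
elim: l => [|a l IH] /=; first by move=> _ ->; rewrite orbT.
case/andP=> le_an Alr /orP[/andP[a_lr lt_h]|/IH-> //]; last by rewrite orbT.
apply/orP; left; rewrite mem_cat inE orbCA -mem_cat a_lr orbT /=.
case: l a_lr lt_h Alr {IH} => [|b l] /= a_r lt_h Alr; last exact: lt_h.
by have := allP Alr _ a_r; lia.
Qed.

(** The new largest entry can only play the role of the large middle letter,
    with the last entry of [l] as the small one. *)
Lemma has_P_insert n l r : all (leq^~ n) (l ++ r) -> ~~ has_P (l ++ r) ->
  has_P (l ++ n.+1 :: r) = ~~ open_site l r.
Proof.
rewrite /open_site; elim: l => [|a l IH] /=.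
  by move=> /allP Ar /negPf->; rewrite orbF; case: (boolP (_ \in r)) => // /Ar; lia.
case/andP=> le_an Alr; rewrite negb_or => /andP[a_lr no_P].
rewrite {}IH //; move: a_lr; case: l Alr no_P => [|b l] /= Alr no_P a_lr.
  rewrite orbF inE negbK eqSS; case: (boolP (_ \in r)) => [|_].
    by move/(allP Alr) => lt_an; rewrite orbT; lia.
  by rewrite orbF; case: eqP => // ->; rewrite ltnn.
case: (a.+1 \in _) / boolP => // a_lr'.
case: ltnP => //= lt_ab; case/andP: Alr => le_bn _.
move: a_lr; rewrite lt_ab andbT; move: a_lr'.
rewrite !inE !mem_cat inE => /or3P[-> //|-> |/orP[|->]]; rewrite ?orbT //.
by move/eqP=> ?; lia.
Qed.

Lemma S_P_size n s : s \in S_P n -> size s = n.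
Proof. by case/andP=> /perm_size->; rewrite size_iota. Qed.

Lemma S_P_uniq n s : s \in S_P n -> uniq s.
Proof. by case/andP=> /perm_uniq->; rewrite iota_uniq. Qed.

Lemma S_P_mem n s a : s \in S_P n -> (a \in s) = (0 < a <= n).
Proof. by case/andP=> /perm_mem-> _; rewrite mem_iota add1n ltnS. Qed.

Lemma S_P_all n s : s \in S_P n -> all (leq^~ n) s.
Proof. by move=> Ss; apply/allP => a; rewrite (S_P_mem a Ss) => /andP[]. Qed.

Lemma perm_insert n l r :
  perm_eq (l ++ n.+1 :: r) (iota 1 n.+1) = perm_eq (l ++ r) (iota 1 n).
Proof.
have -> : iota 1 n.+1 = iota 1 n ++ [:: n.+1].
  by rewrite -[in LHS](addn1 n) iotaD add1n.
by rewrite (perm_catCA l [:: n.+1] r) perm_sym perm_catC /= perm_cons perm_sym.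
Qed.

Lemma S_P_insert n l r : l ++ r \in S_P n ->
  (l ++ n.+1 :: r \in S_P n.+1) = open_site l r.
Proof.
move=> Slr; have Alr := S_P_all Slr; case/andP: Slr => perm_lr.
rewrite contains_PE !inE perm_insert perm_lr contains_PE => no_P /=.
by rewrite has_P_insert // negbK.
Qed.

Lemma S_P_rem n l r : l ++ n.+1 :: r \in S_P n.+1 -> l ++ r \in S_P n.
Proof.
rewrite !inE perm_insert !contains_PE => /andP[perm_lr no_P]; rewrite perm_lr.
apply: contra no_P; apply: has_P_rem; apply/allP => a.
by rewrite (perm_mem perm_lr) mem_iota add1n ltnS => /andP[].
Qed.

Lemma count_open_site l r :
  count (fun k => open_site (take k (l ++ r)) (drop k (l ++ r)))
        (iota (size l).+1 (size r)) = sites_after r.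
Proof.
elim: r l => [//|a r IH] l /=.
rewrite -cat_rcons -(size_rcons l a) IH; congr (nat_of_bool _ + _).
rewrite take_size_cat // drop_size_cat // /open_site last_rcons.
by case: l.
Qed.

Lemma active_sitesE n s : s \in S_P n ->
  active_sites n.+1 s = rev [seq k <- iota 0 (size s).+1 |
                               open_site (take k s) (drop k s)].
Proof.
move=> Ss; rewrite /active_sites filter_rev; congr rev; apply: eq_filter => k.
by rewrite S_P_insert // cat_take_drop.
Qed.

Lemma size_active_sites n s : s \in S_P n ->
  size (active_sites n.+1 s) = (sites_after s).+1.
Proof.
move=> Ss; rewrite active_sitesE // size_rev size_filter /=.
by rewrite -[in RHS](count_open_site [::]) take0.
Qed.

(** The label of an active site depends only on what follows it. *)
Lemma index_active_sites n l r : l ++ r \in S_P n -> open_site l r ->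
  index (size l) (active_sites n.+1 (l ++ r)) = sites_after r.
Proof.
move=> Slr lr; rewrite active_sitesE // size_cat -addnS iotaD filter_cat rev_cat.
rewrite /= add0n take_size_cat // drop_size_cat // lr rev_cons cat_rcons.
rewrite index_cat mem_rev mem_filter mem_iota ltnn andbF /= eqxx addn0 size_rev.
by rewrite size_filter count_open_site.
Qed.

Lemma sites_after_cons a s :
  sites_after (a :: s) = (a.+1 \notin s) + sites_after s.
Proof. by []. Qed.

Arguments sites_after : simpl never.

(** * How insertion changes the statistics *)

(** The LR-maxima, and below the RL-maxima, that have [j + 1] active sites to
    their right.  Each has at least one, whence the shift. *)
Definition LRmax_profile (s : seq nat) (j : nat) : nat :=
  count_split (fun p a r => all (fun y => y < a) p && (sites_after (a :: r) == j.+1))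
    [::] s [::].

Definition RLmax_profile (s : seq nat) (j : nat) : nat :=
  count_split (fun _ a r => all (fun y => y < a) r && (sites_after (a :: r) == j.+1))
    [::] s [::].

Lemma predn_sites_after_lt u a v m :
  sites_after (u ++ a :: v) = m -> (sites_after (a :: v)).-1 < m.
Proof. by move=> <-; rewrite prednK ?sites_after_gt0 ?leq_sites_after. Qed.

Lemma sum_LRmax_profile s : \sum_(j < sites_after s) LRmax_profile s j = LRmax s.
Proof.
rewrite [RHS](count_iota_split (fun p a _ => all (fun y => y < a) p)).
rewrite -(@sum_count_split _ (fun a r => (sites_after (a :: r)).-1) (sites_after s)).
  apply: eq_bigr => j _; apply: eq_count_split => u a v _.
  by rewrite -(eqSS _.-1) prednK ?sites_after_gt0.
by move=> u a v ->; rewrite cats0; apply: (@predn_sites_after_lt u).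
Qed.

Lemma sum_RLmax_profile s : \sum_(j < sites_after s) RLmax_profile s j = RLmax s.
Proof.
rewrite [RHS](count_iota_split (fun _ a r => all (fun y => y < a) r)).
rewrite -(@sum_count_split _ (fun a r => (sites_after (a :: r)).-1) (sites_after s)).
  apply: eq_bigr => j _; apply: eq_count_split => u a v _.
  by rewrite -(eqSS _.-1) prednK ?sites_after_gt0.
by move=> u a v ->; rewrite cats0; apply: (@predn_sites_after_lt u).
Qed.

Section Insertion.
Variables (n : nat) (l r : seq nat).
Hypotheses (lr_S : l ++ r \in S_P n) (lr_open : open_site l r).

Let lr_le : all (leq^~ n) (l ++ r) := S_P_all lr_S.
Let l_le a : a \in l -> a <= n.
Proof. by move=> al; apply: (allP lr_le); rewrite mem_cat al. Qed.
Let r_le a : a \in r -> a <= n.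
Proof. by move=> ar; apply: (allP lr_le); rewrite mem_cat ar orbT. Qed.

(** The largest entry [n] of the old word may lie in the part of [l] that is cut
    off; then the suffix just gains a site. *)
Lemma sites_after_insert_suffix u v : l = u ++ v ->
  sites_after (v ++ n.+1 :: r) = (n \notin v) + sites_after (v ++ r).
Proof.
move=> El; have := S_P_uniq lr_S; rewrite El -catA cat_uniq => /and3P[_ _ Uvr].
apply: sites_after_insert => //; last by apply/negP => /r_le; lia.
by rewrite mem_cat; apply/norP; split; apply/negP;
  [move=> h; have := @l_le n.+1; rewrite El mem_cat h orbT => /(_ isT)
  |move/r_le]; lia.
Qed.

Lemma ltn_sites_after_suffix u a v :
  l = u ++ a :: v -> sites_after r < sites_after (a :: v ++ r).
Proof.
move=> El; apply: ltn_sites_after_open; move: lr_open; rewrite El /open_site.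
by case: u {El} => //= b u; rewrite last_cat.
Qed.

Lemma leq_sites_after_suffix u a v :
  r = u ++ a :: v -> sites_after (a :: v) <= sites_after r.
Proof. by move=> ->; apply: leq_sites_after. Qed.

(** Entries of [l] stop being RL-maxima.  As the site of insertion is active,
    entries of [l] have more than [sites_after r] sites to their right, and
    entries of [r] at most that many; so the profile is kept below the label
    and erased above it. *)
Lemma RLmax_profile_insert j : RLmax_profile (l ++ n.+1 :: r) j =
  if j < sites_after r then RLmax_profile (l ++ r) j else j == sites_after r.
Proof.
rewrite /RLmax_profile !count_split_cat [X in X + _]count_split0 => [|u a v El];
  last first.
  rewrite all_cat /= ltnNge (leqW (l_le _)) ?andbF //.
  by rewrite El mem_cat inE eqxx orbT.
rewrite add0n /= !cats0.
have -> : all (ltn^~ n.+1) r by apply/allP => a ar; rewrite /= ltnS r_le.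
rewrite sites_after_cons; have -> : n.+2 \notin r by apply/negP => /r_le; lia.
rewrite add1n eqSS /= eq_sym.
rewrite (@eq_count_split _ (fun _ a r =>
  all (ltn^~ a) r && (sites_after (a :: r) == j.+1))
           _ [::] r [::] [::]) //.
case: ltnP => [lt_jr | le_rj].
  rewrite (ltn_eqF lt_jr) add0n [X in _ = X + _]count_split0.
    by rewrite add0n; apply: eq_count_split.
  move=> u a v El; apply: contraTF lt_jr => /andP[_ /eqP Ej].
  by have := ltn_sites_after_suffix El;
    rewrite -[_ :: _ ++ _]/(a :: (v ++ r)) Ej ltnS -leqNgt.
rewrite [X in _ + X]count_split0 ?addn0 // => u a v Er.
by apply: contraTF le_rj => /andP[_ /eqP Ej]; rewrite -ltnNge -ltnS;
  have := leq_sites_after_suffix Er; rewrite cats0 in Ej; rewrite Ej.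
Qed.

(** If [n] is in [l], then nothing in [r] was an LR-maximum, and every LR-maximum
    sees the site after [n] replaced by the one after [n.+1].  If [n] is in
    [r], the LR-maxima of [r] disappear and those of [l] gain a site.  The cases
    are the effect of the addition rules on the last column of a matrix. *)
Lemma LRmax_profile_insert j : LRmax_profile (l ++ n.+1 :: r) j =
  if n \in l then LRmax_profile (l ++ r) j + (j == sites_after r)
  else if j < sites_after r then 0 else if j == sites_after r then 1 else
    LRmax_profile (l ++ r) j.-1.
Proof.
rewrite /LRmax_profile !count_split_cat /= !cats0.
rewrite [count_split _ (rcons l _) r _]count_split0 ?addn0 => [|u a v Er]; last first.
  rewrite all_cat all_rcons ltnNge (leqW (r_le _)) //.
  by rewrite Er mem_cat inE eqxx orbT.
have -> : all (ltn^~ n.+1) l by apply/allP => a al; rewrite /= ltnS l_le.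
rewrite sites_after_cons; have -> : n.+2 \notin r by apply/negP => /r_le; lia.
rewrite add1n eqSS /= (eq_sym _ j).
case: ifP => [nl|/negbT n_l].
  rewrite [count_split _ l r _]count_split0 ?addn0 => [|u a v Er]; last first.
    apply/negP=> /andP[/allP/(_ n)]; rewrite mem_cat nl => /(_ isT).
    by rewrite ltnNge r_le // Er mem_cat inE eqxx orbT.
  congr (_ + _); apply: eq_count_split => u a v El.
  rewrite -!cat_cons (@sites_after_insert_suffix u) //.
  case: (boolP (n \in a :: v)) => //= n_av.
  have nu : n \in u by move: nl; rewrite El mem_cat (negPf n_av) orbF.
  suff -> : all (ltn^~ a) u = false by [].
  apply/negP=> /allP/(_ n nu) /=; rewrite ltnNge l_le //.
  by rewrite El mem_cat inE eqxx orbT.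
have E u a v : l = u ++ a :: v ->
  sites_after (a :: v ++ n.+1 :: r) = (sites_after (a :: v ++ r)).+1.
  move=> El; rewrite -!cat_cons (sites_after_insert_suffix El).
  by move: n_l; rewrite El mem_cat negb_or => /andP[_ ->].
case: (ltngtP j (sites_after r)) => [lt_jr|lt_rj|->].
- rewrite addn0 count_split0 // => u a v El; rewrite (E u) // eqSS.
  by have := ltn_sites_after_suffix El => H;
    rewrite gtn_eqF ?andbF // (ltn_trans lt_jr).
- rewrite addn0 [count_split _ l r _]count_split0 ?addn0 => [|u a v Er].
    apply: eq_count_split => u a v El; rewrite (E u) // eqSS prednK //.
    exact: leq_ltn_trans lt_rj.
  rewrite cats0 prednK ?(leq_ltn_trans _ lt_rj) // ltn_eqF ?andbF //.
  exact: leq_ltn_trans (leq_sites_after_suffix Er) lt_rj.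
rewrite count_split0 // => u a v El; rewrite (E u) // eqSS.
by rewrite gtn_eqF ?andbF // (ltn_sites_after_suffix El).
Qed.

Lemma LRmin_insert : LRmin (l ++ n.+1 :: r) = LRmin (l ++ r) + (l == [::]).
Proof.
rewrite /LRmin !(count_iota_split (fun p a _ => all (ltn a) p)) !count_split_cat /=.
rewrite (@eq_count_split _ (fun p a _ => all (ltn a) p) [::] [::] l _ r) // ?cats0.
rewrite -!addnA; congr (_ + _); rewrite addnC; congr (_ + _).
  apply: eq_count_split => u a v Er; rewrite cat_rcons !all_cat /= ltnS r_le //.
  by rewrite Er mem_cat inE eqxx orbT.
congr nat_of_bool; case: (l) l_le => //= a s /(_ a); rewrite inE eqxx => /(_ isT) le_an.
by rewrite ltnNge (leqW le_an).
Qed.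

Lemma RLmin_insert : RLmin (l ++ n.+1 :: r) = RLmin (l ++ r) + (r == [::]).
Proof.
rewrite /RLmin !(count_iota_split (fun _ a r =>
  all (ltn a) r)) !count_split_cat /= !cats0.
rewrite (@eq_count_split _ (fun _ a r => all (ltn a) r) [::] [::] l _ r); last first.
  move=> u a v El; rewrite !all_cat /= ltnS l_le //.
  by rewrite El mem_cat inE eqxx orbT.
rewrite -!addnA; congr (_ + _); rewrite addnC; congr (_ + _).
  exact: eq_count_split.
congr nat_of_bool; case: (r) r_le => //= a s /(_ a); rewrite inE eqxx => /(_ isT) le_an.
by rewrite ltnNge (leqW le_an).
Qed.

End Insertion.

(** * Matrices as functions on pairs of numbers *)

(** Extending by zero makes matrices of different dimensions comparable and
    spares the arithmetic of ordinals. *)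
Definition entry (A : sqmx) (s t : nat) : nat :=
  if (s <= tag A) && (t <= tag A) then tagged A (inord s) (inord t) else 0.

Lemma entry_ord (A : sqmx) (i j : 'I_(tag A).+1) : entry A i j = tagged A i j.
Proof. by rewrite /entry !leq_ord /= !inord_val. Qed.

Lemma entry_out A s t : (tag A < s) || (tag A < t) -> entry A s t = 0.
Proof. by rewrite /entry !ltnNge -negb_and => /negPf->. Qed.

Lemma entry_bound A s t : entry A s t != 0 -> (s <= tag A) && (t <= tag A).
Proof. by apply: contraR; rewrite negb_and -!ltnNge => /entry_out->. Qed.

Lemma entry_ext (A : sqmx) (f : nat -> nat -> nat) :
  (forall i j : 'I_(tag A).+1, tagged A i j = f i j) ->
  forall s t, s <= tag A -> t <= tag A -> entry A s t = f s t.
Proof.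
by move=> H s t les let_; rewrite -(inordK les) -(inordK let_) entry_ord H.
Qed.

Lemma sqmx_eq A B : tag A = tag B ->
  (forall s t, s <= tag A -> t <= tag A -> entry A s t = entry B s t) -> A = B.
Proof.
case: A B => [d M] [d' N] /= Ed; subst d' => H; congr existT.
apply/matrixP => i j.
have := H i j; rewrite /= !leq_ord => /(_ isT isT).
by rewrite (entry_ord (A := Sqmx M)) (entry_ord (A := Sqmx N)).
Qed.

Definition mx_of_fun (d : nat) (f : nat -> nat -> nat) : sqmx :=
  Sqmx (\matrix_(i < d.+1, j < d.+1) f i j).

Lemma entry_mx_of_fun d f s t : s <= d -> t <= d -> entry (mx_of_fun d f) s t = f s t.
Proof. by apply: (@entry_ext (mx_of_fun d f)) => i j; rewrite mxE. Qed.

Definition is_fishburn (A : sqmx) : Prop :=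
  [/\ forall s t, t < s -> entry A s t = 0,
      forall s, s <= tag A -> exists t, entry A s t != 0
    & forall t, t <= tag A -> exists s, entry A s t != 0].

Lemma is_fishburnP A : reflect (is_fishburn A) (fishburn (tagged A)).
Proof.
apply: (iffP and3P) => [[/forallP tri /forallP rows /forallP cols]|[tri rows cols]].
  split=> [s t lt_ts | s le_s | t le_t].
  - case: (boolP ((s <= tag A) && (t <= tag A))) => [/andP[le_s le_t]|].
      rewrite -(inordK le_s) -(inordK le_t) entry_ord; apply/eqP.
      apply: (implyP (forallP (tri (inord s)) (inord t))).
      by rewrite !inordK.
    by rewrite negb_and -!ltnNge => /entry_out.
  - have /existsP[j nz] := rows (inord s).
    by exists j; rewrite -(inordK le_s) entry_ord.
  have /existsP[i nz] := cols (inord t).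
  by exists i; rewrite -(inordK le_t) entry_ord.
split; apply/forallP => i.
- by apply/forallP => j; apply/implyP => lt_ji; rewrite -entry_ord tri.
- have [|t nz] := rows i; first exact: leq_ord.
  apply/existsP; exists (inord t); rewrite -entry_ord inordK //.
  by have /andP[] := entry_bound nz.
have [|s nz] := cols i; first exact: leq_ord.
apply/existsP; exists (inord s); rewrite -entry_ord inordK //.
by have /andP[] := entry_bound nz.
Qed.

Definition mxidx (A : sqmx) : nat := mxindex (tagged A).

Lemma mxidxE A : mxidx A = (find (fun s =>
  0 < entry A s (tag A)) (iota 0 (tag A).+1)).+1.
Proof.
rewrite /mxidx /mxindex -val_enum_ord find_map; congr _.+1; apply: eq_find => i /=.
by rewrite -(entry_ord i ord_max).
Qed.

Lemma mxidx_eq A i : entry A i (tag A) != 0 ->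
  (forall s, s < i -> entry A s (tag A) = 0) -> mxidx A = i.+1.
Proof.
move=> nz z; have /andP[le_i _] := entry_bound nz; rewrite mxidxE; congr _.+1.
have -> : iota 0 (tag A).+1 = iota 0 i ++ i :: iota i.+1 (tag A - i).
  by rewrite -[in LHS](subnKC le_i) -addnS iotaD.
rewrite find_cat /= lt0n nz addn0 size_iota.
case: hasP => // -[s]; rewrite mem_iota => /andP[_ lt_si].
by rewrite (z s lt_si).
Qed.

Lemma is_fishburn_last A : is_fishburn A -> exists2 i, i <= tag A &
  [/\ mxidx A = i.+1, entry A i (tag A) != 0 & forall s, s < i ->
    entry A s (tag A) = 0].
Proof.
case=> _ _ /(_ _ (leqnn _)) ex; case: (ex_minnP ex) => i nz min_i.
have z s : s < i -> entry A s (tag A) = 0.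
  by move=> lt_si; apply/eqP; apply: contraLR lt_si => /min_i; rewrite -leqNgt.
exists i; first by have /andP[] := entry_bound nz.
by split=> //; apply: mxidx_eq.
Qed.

Lemma mxidx_le_dim A : is_fishburn A -> mxidx A <= (tag A).+1.
Proof. by case/is_fishburn_last => j le_j [-> _ _]. Qed.

(** * Entries after the first two addition rules *)

Lemma g_add1 A i : i < mxidx A -> i <= tag A ->
  tag (g A i) = tag A /\
  forall s t, entry (g A i) s t = entry A s t + ((s == i) && (t == tag A)).
Proof.
case: A => d M /= lt_i le_i; rewrite /g; have -> : i < mxindex M by [].
split=> // s t.
case: (boolP ((s <= d) && (t <= d))) => [/andP[le_s le_t]|].
  rewrite (@entry_ext (Sqmx (add1 M i))
    (fun s t => entry (existT _ d M) s t + ((s == i) && (t == d)))) // => {le_s le_t}.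
  by move=> x y; rewrite /= mxE (entry_ord (A := Sqmx M)).
rewrite negb_and -!ltnNge => out; rewrite !entry_out //.
by rewrite [RHS]add0n; lia.
Qed.

Lemma g_add2 A : mxidx A <= (tag A).+1 ->
  tag (g A (tag A).+1) = (tag A).+1 /\
  forall s t, entry (g A (tag A).+1) s t =
    entry A s t + ((s == (tag A).+1) && (t == (tag A).+1)).
Proof.
case: A => d M /= le_i; rewrite /g ltnNge; have -> /= : mxindex M <= d.+1 by [].
rewrite eqxx; have Etag : tag (Sqmx (add2 M)) = d.+1 by apply: (addn1 d).
split=> // s t.
case: (boolP ((s <= d.+1) && (t <= d.+1))) => [/andP[le_s le_t]|].
  rewrite (@entry_ext (Sqmx (add2 M))
    (fun s t => entry (existT _ d M) s t + ((s == d.+1) && (t == d.+1)))) ?Etag //.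
  move=> {s t le_s le_t} /= x y; rewrite /add2.
  have ltS (z : 'I_d.+1) : (z == d.+1 :> nat) = false by rewrite ltn_eqF.
  rewrite !mxE; case: (splitP (x : 'I_(d.+1 + 1))) => x' Ex.
    rewrite mxE; case: (splitP (y : 'I_(d.+1 + 1))) => y' Ey;
      rewrite [X in _ == X]/= in Ex Ey *.
      by rewrite Ex Ey !ltS addn0 (entry_ord (A := Sqmx M)).
    by rewrite mxE Ex Ey ltS entry_out ?orbT //= ltnS leq_addr orbT.
  rewrite mxE; case: (splitP (y : 'I_(d.+1 + 1))) => y' Ey.
    by rewrite mxE Ex Ey ltS andbF entry_out //= ltnS leq_addr.
  by rewrite mxE Ex Ey !ord1 !addn0 !eqxx entry_out //= leqnn.
rewrite negb_and -!ltnNge => out.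
rewrite [LHS]entry_out ?Etag // entry_out /=; first by case: eqP out => // ->;
  case: eqP => // ->; rewrite ltnn.
by case/orP: out => /ltnW->; rewrite ?orbT.
Qed.

(** * Relabelling of columns *)

(** [f], supported on the list [X], is carried to a function supported on [Y]:
    the value at the m-th element of [X] is put at the m-th element of [Y]. *)
Definition transport (X Y : seq nat) (f : nat -> nat) (t : nat) : nat :=
  if t \in Y then f (nth 0 X (index t Y)) else 0.

Section Transport.
Variables X Y : seq nat.
Hypotheses (UX : uniq X) (UY : uniq Y) (eqXY : size X = size Y).

Lemma transport_nth f m : m < size Y -> transport X Y f (nth 0 Y m) = f (nth 0 X m).
Proof. by move=> lt_m; rewrite /transport mem_nth // index_uniq. Qed.

Lemma transportK f u : (forall u, u \notin X -> f u = 0) ->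
  transport Y X (transport X Y f) u = f u.
Proof.
move=> f0; rewrite {1}/transport; case: (boolP (u \in X)) => [uX|/f0->//].
by rewrite transport_nth ?nth_index // -eqXY index_mem.
Qed.

Lemma eq_transport f g t : {in X, f =1 g} -> transport X Y f t = transport X Y g t.
Proof.
move=> fg; rewrite /transport; case: ifP => // tY.
by rewrite fg // mem_nth // eqXY index_mem.
Qed.

Lemma transport_sum f : \sum_(t <- Y) transport X Y f t = \sum_(u <- X) f u.
Proof.
rewrite [LHS](big_nth 0) [RHS](big_nth 0) eqXY !big_mkord; apply: eq_bigr => m _.
exact: transport_nth.
Qed.

Lemma transport_neq0 f u :
  u \in X -> f u != 0 -> exists2 t, t \in Y & transport X Y f t = f u.
Proof.
move=> uX nz; have lt_m : index u X < size Y by rewrite -eqXY index_mem.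
exists (nth 0 Y (index u X)); first exact: mem_nth.
by rewrite transport_nth // nth_index.
Qed.

End Transport.

Lemma leq_nth_sorted X i j : sorted ltn X -> i < size X -> j < size X ->
  (nth 0 X i <= nth 0 X j) = (i <= j).
Proof.
move=> sX lt_i lt_j; apply: (leq_mono_in (D := [pred i | i < size X])) =>
  // x y xX yX lt_xy.
exact: (sorted_ltn_nth ltn_trans 0 sX).
Qed.

(** Row [j] contains a wNE-cell: its last nonzero cell lies strictly to the right
    of every nonzero cell above.  Such a cell is unique in its row, so that
    wNE-cells can be counted by rows. *)
Definition row_record (M : nat -> nat -> nat) (j : nat) : Prop :=
  exists2 t, M j t != 0 & forall s t', s < j -> t <= t' -> M s t' = 0.

Lemma eq_row_record M N j : (forall s t, s <= j -> M s t = N s t) ->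
  row_record M j <-> row_record N j.
Proof.
move=> E; split=> -[t nz z]; exists t; rewrite -?E // ?E // => s t' lt_sj le_t.
  by rewrite -E ?z // ltnW.
by rewrite E ?z // ltnW.
Qed.

(** The condition only compares columns, so it survives an increasing
    relabelling of the nonzero ones. *)
Lemma row_record_transport X Y (F G : nat -> nat -> nat) j :
  sorted ltn X -> sorted ltn Y -> size X = size Y ->
  (forall s t, s <= j -> F s t = transport X Y (G s) t) ->
  (forall s u, s <= j -> u \notin X -> G s u = 0) ->
  row_record F j -> row_record G j.
Proof.
move=> sX sY eqXY FG G0 [t]; rewrite FG // /transport.
case: ifP => // tY nz z; exists (nth 0 X (index t Y)) => // s u lt_sj le_u.
case: (boolP (u \in X)) => [uX|]; last by apply: G0; apply: ltnW.
have lt_m : index u X < size Y by rewrite -eqXY index_mem.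
have := z s (nth 0 Y (index u X)) lt_sj.
rewrite FG ?(ltnW lt_sj) // transport_nth ?(sorted_uniq ltn_trans ltnn) // nth_index //.
apply; rewrite -{1}(nth_index 0 tY) leq_nth_sorted ?index_mem //.
by rewrite -(leq_nth_sorted sX) ?eqXY ?index_mem // nth_index.
Qed.

(** For the third addition rule at row [k] of a matrix with last column [d],
    where [p] tells which columns are nonzero above row [k]: [old_cols] are
    these columns (column [d] always being one of them), and [new_cols] those
    of the new matrix.  After the insertion of column [k] the old columns from
    [k] on are shifted by one; moving each content to the preceding nonzero
    column frees the last column and fills column [k]. *)
Definition old_cols (p : pred nat) (k d : nat) : seq nat :=
  [seq u <- iota 0 k | p u] ++ rcons [seq u <- iota k (d - k) | p u] d.

Definition new_cols (p : pred nat) (k d : nat) : seq nat :=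
  [seq u <- iota 0 k | p u] ++ k :: map S [seq u <- iota k (d - k) | p u].

Section Cols.
Variables (p : pred nat) (k d : nat).
Hypotheses (le_kd : k <= d).

Lemma size_cols : size (old_cols p k d) = size (new_cols p k d).
Proof. by rewrite !size_cat size_rcons /= size_map. Qed.

Let iota_split : iota 0 d.+1 = iota 0 k ++ iota k (d - k) ++ [:: d].
Proof.
have {1}-> : d.+1 = k + ((d - k) + 1) by lia.
by rewrite !iotaD add0n subnKC.
Qed.

Lemma mem_old_cols u : (u \in old_cols p k d) = (u == d) || (u < d) && p u.
Proof.
rewrite mem_cat mem_rcons inE !mem_filter !mem_iota add0n subnKC //.
by case: (p u) => //=; lia.
Qed.

Lemma mem_new_cols t :
  (t \in new_cols p k d) = [|| (t < k) && p t, t == k | (k < t <= d) && p t.-1].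
Proof.
rewrite mem_cat inE !mem_filter !mem_iota add0n andbC; congr [|| _, _ | _].
case: t => [|t]; first by apply/negP => /mapP[].
rewrite mem_map; last exact: succn_inj.
by rewrite mem_filter mem_iota subnKC // andbC.
Qed.

Lemma sorted_old_cols : sorted ltn (old_cols p k d).
Proof.
rewrite /old_cols -[rcons _ _]cats1.
have -> : [seq u <- iota 0 k | p u] ++ [seq u <- iota k (d - k) | p u] ++ [:: d] =
          [seq u <- iota 0 d.+1 | (u == d) || p u].
  rewrite iota_split !filter_cat /= eqxx.
  congr (_ ++ _ ++ _); apply: eq_in_filter => u; rewrite mem_iota => H;
    by case: eqP => // Eu; lia.
exact: (sorted_filter ltn_trans _ (iota_ltn_sorted 0 _)).
Qed.

Lemma sorted_new_cols : sorted ltn (new_cols p k d).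
Proof.
have -> : new_cols p k d = [seq t <- iota 0 d.+1 | if t < k then p t else (t == k) ||
  p t.-1].
  have -> : d.+1 = k + (1 + (d - k)) by lia.
  rewrite !iotaD !filter_cat /= ltnn eqxx /= add0n addn1; congr (_ ++ _ :: _).
    by apply: eq_in_filter => u; rewrite mem_iota /= => ->.
  rewrite (iotaDl 1 k) filter_map; congr map; apply: eq_in_filter => u.
  rewrite mem_iota /= add1n => /andP[le_ku _].
  by rewrite ltnNge leqW //= gtn_eqF.
exact: (sorted_filter ltn_trans _ (iota_ltn_sorted 0 _)).
Qed.

(** The two lists agree below [k], so these columns stay where they are. *)
Lemma transport_ltk f t : t < k -> (forall u, u < k -> ~~ p u -> f u = 0) ->
  transport (old_cols p k d) (new_cols p k d) f t = f t /\
  transport (new_cols p k d) (old_cols p k d) f t = f t.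
Proof.
move=> lt_tk f0; rewrite /transport mem_old_cols mem_new_cols lt_tk.
rewrite (ltn_eqF lt_tk) (ltn_eqF (leq_trans lt_tk le_kd)) (leq_trans lt_tk le_kd) /=.
rewrite [k < t]ltnNge (ltnW lt_tk) /= orbF.
case: ifP => [pt|/negbT/(f0 t lt_tk)-> //].
have tL : t \in [seq u <- iota 0 k | p u] by rewrite mem_filter pt mem_iota.
by rewrite /old_cols /new_cols !index_cat tL !nth_cat index_mem tL nth_index.
Qed.

End Cols.

(** * Entries after the third addition rule *)

Definition nonzero_above (A : sqmx) (k u : nat) : bool :=
  has (fun s => entry A s u != 0) (iota 0 k).

Lemma nonzero_aboveP A k u :
  reflect (exists2 s, s < k & entry A s u != 0) (nonzero_above A k u).
Proof.
apply: (iffP hasP) => [[s]|[s lt_sk nz]]; last by exists s; rewrite ?mem_iota.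
by rewrite mem_iota => lt_sk nz; exists s.
Qed.

Lemma nonzero_above0 A k s u : s < k -> ~~ nonzero_above A k u -> entry A s u = 0.
Proof. by move=> lt_sk /nonzero_aboveP H; apply/eqP/negP => /negP nz; apply: H;
  exists s. Qed.

Definition add3_entry (A : sqmx) (k s t : nat) : nat :=
  let p := nonzero_above A k in
  if s < k then transport (old_cols p k (tag A)) (new_cols p k (tag A)) (entry A s) t
  else if s == k then nat_of_bool (t == (tag A).+1)
  else if t == k then 0 else entry A s.-1 (unbump k t).

Section Add3.
Variables (d : nat) (M : 'M[nat]_d.+1) (k : 'I_d.+2).
Let A : sqmx := Sqmx M.
Hypotheses (le_kd : k <= d) (nz_d : nonzero_above A k d).

Lemma add3_insertE (s t : 'I_d.+2) : add3_insert M k s t =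
  if s == k :> nat then nat_of_bool (t == d.+1 :> nat)
  else if t == k :> nat then 0 else entry A (unbump k s) (unbump k t).
Proof.
rewrite mxE; case: unliftP => [s' ->|->]; last by rewrite eqxx -val_eqE.
case: unliftP => [t' ->|->]; last by rewrite eqxx /= eq_sym (negPf (neq_bump _ _)).
rewrite /= !bumpK -(entry_ord (A := A)) !(eq_sym (bump _ _)).
by rewrite !(negPf (neq_bump _ _)).
Qed.

Lemma add3_colsE : map val (add3_cols (add3_insert M k) k) =
  map S (rcons [seq u <- iota k (d - k) | nonzero_above A k u] d).
Proof.
pose q t := (k < t) && nonzero_above A k t.-1.
have -> : map val (add3_cols (add3_insert M k) k) = [seq t <- iota 0 d.+2 | q t].
  rewrite -val_enum_ord filter_map; congr map; apply: eq_filter => t /=.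
  rewrite /q; case: (ltngtP k t) => //= [lt_kt|Ekt].
    apply/existsP/nonzero_aboveP => [[s /andP[lt_sk]]|[s lt_sk nz]].
      rewrite add3_insertE (ltn_eqF lt_sk) (gtn_eqF lt_kt) => nz.
      exists s => //; move: nz; rewrite /unbump lt_kt subn1.
      by rewrite ltnNge (ltnW lt_sk) subn0.
    have lt_s : s < d.+2 by lia.
    exists (Ordinal lt_s);
      rewrite /= lt_sk add3_insertE /= (ltn_eqF lt_sk) (gtn_eqF lt_kt).
    by rewrite /unbump lt_kt subn1 ltnNge (ltnW lt_sk) subn0.
  apply/existsP => -[s /andP[lt_sk]]; rewrite add3_insertE (ltn_eqF lt_sk) Ekt eqxx.
  by [].
have -> : iota 0 d.+2 = iota 0 k.+1 ++ map S (iota k (d - k + 1)).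
  by rewrite -(iotaDl 1 k) -iotaD; congr iota; lia.
rewrite filter_cat.
rewrite (eq_in_filter (a2 := pred0)) ?filter_pred0 => [|t]; last first.
  by rewrite mem_iota /q => /andP[_]; rewrite add0n ltnS => le_tk; rewrite ltnNge le_tk.
rewrite cat0s filter_map; congr map;
  rewrite iotaD filter_cat subnKC //= /q /= ltnS le_kd nz_d.
rewrite cats1; congr rcons; apply: eq_in_filter => u;
  rewrite mem_iota => /andP[le_ku _].
by rewrite /= ltnS le_ku.
Qed.

Lemma entry_add3 s t : s <= d.+1 -> t <= d.+1 ->
  entry (Sqmx (add3 M k)) s t = add3_entry A k s t.
Proof.
apply: (@entry_ext (Sqmx (add3 M k))) => {s t} /= s t; rewrite mxE /add3_entry.
case: (ltnP s k) => [lt_sk|le_ks]; last first.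
  rewrite add3_insertE; case: eqVneq => // ne_sk.
  by rewrite /unbump [k < s]ltn_neqAle (eq_sym (k : nat)) ne_sk le_ks subn1.
set p := nonzero_above A k; set Y := (k : nat) :: map S [seq u <- iota k (d - k) | p u].
(* The list [c] of the definition is [Y] followed by the last column. *)
move Dc: (k :: add3_cols (add3_insert M k) k) => c.
have Ec : map val c = rcons Y d.+1 by rewrite -Dc /= add3_colsE map_rcons.
have Aout u : u < k -> ~~ p u -> entry A s u = 0 by move=> _; apply: nonzero_above0.
have Et : (t == ord_max) = (t == d.+1 :> nat) by rewrite -val_eqE.
have -> : (t \in c) = (val t \in rcons Y d.+1).
  by rewrite -Ec (mem_map val_inj).
case: (ltnP t k) => [lt_tk|le_kt].
  rewrite (transport_ltk le_kd lt_tk Aout).1 Et ifF; last by apply/eqP => Etd; lia.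
  rewrite ifF; last first.
    rewrite mem_rcons !inE; apply/or3P => /= -[/eqP|/eqP|/mapP[u]]; [lia | lia |].
    by rewrite mem_filter mem_iota; lia.
  rewrite add3_insertE /unbump (ltn_eqF lt_sk) (ltn_eqF lt_tk) [k < s]ltnNge [k <
    t]ltnNge.
  by rewrite (ltnW lt_sk) (ltnW lt_tk) !subn0.
rewrite /transport -[new_cols _ _ _]/([seq u <- iota 0 k | p u] ++ Y) /old_cols mem_cat.
have -> : (val t \in [seq u <- iota 0 k | p u]) = false.
  by rewrite mem_filter mem_iota add0n ltnNge le_kt andbF.
rewrite orFb Et mem_rcons in_cons; case: (eqVneq (t : nat) d.+1) => [->|ne_td] /=.
  case: ifP => //; rewrite in_cons; case: eqP => [|_] /=; first by lia.
  by case/mapP=> u; rewrite mem_filter mem_iota; lia.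
case: ifP => [tY|/negbT t_nY].
  have lt_m : index (t : nat) Y < size Y by rewrite index_mem.
  rewrite index_cat mem_filter mem_iota add0n [t < k]ltnNge le_kt andbF.
  rewrite nth_cat ltnNge leq_addr addKn.
  have -> : index t c = index (t : nat) Y.
    rewrite -(index_map val_inj) Ec -cats1 index_cat ifT //.
  rewrite add3_insertE (ltn_eqF lt_sk).
  have lt_m' : index (t : nat) Y < size (rcons [seq u <- iota k (d - k) | p u] d).
    by rewrite size_rcons; move: lt_m; rewrite /= size_map.
  set R := rcons _ d in lt_m' *.
  have -> : nth ord_max c (index (t : nat) Y).+1 = (nth 0 R (index (t :
    nat) Y)).+1 :> nat.
    have Ec' : map val c = (k : nat) :: map S R by rewrite Ec /R map_rcons.
    have sz : (index (t : nat) Y).+1 < size c by rewrite -(size_map val) Ec' /= ltnS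
      size_map.
    by rewrite -(nth_map _ 0 val) // Ec' /= (nth_map 0).
  have le_kn : k <= nth 0 R (index (t : nat) Y).
    have : nth 0 R (index (t : nat) Y) \in R by apply: mem_nth.
    by rewrite mem_rcons in_cons mem_filter mem_iota; lia.
  by rewrite gtn_eqF ?ltnS // /unbump ltnS le_kn subn1 /= ltnNge (ltnW lt_sk) subn0.
rewrite add3_insertE (ltn_eqF lt_sk); case: eqP => // /eqP ne_tk.
have lt_kt : k < t by rewrite ltn_neqAle eq_sym ne_tk.
rewrite /unbump lt_kt [k < s]ltnNge (ltnW lt_sk) subn0 subn1 (@nonzero_above0 A k) //.
apply: contra t_nY => pt; rewrite in_cons; apply/orP; right.
apply/mapP; exists t.-1; last by rewrite prednK // (leq_ltn_trans _ lt_kt).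
rewrite mem_filter (pt : p t.-1) mem_iota; have := ltn_ord t; lia.
Qed.

End Add3.

Lemma add3_entry_out A k s t : k <= tag A -> ((tag A).+1 < s) || ((tag A).+1 < t) ->
  add3_entry A k s t = 0.
Proof.
move=> le_k out; rewrite /add3_entry; case: (ltnP s k) => [lt_sk|le_ks].
  rewrite /transport ifF // mem_new_cols //; move: out.
  by rewrite ltnNge ltnW ?ltnS ?(leq_trans (ltnW lt_sk)) //= => lt_t; lia.
case: eqP => [Esk|_]; first by rewrite gtn_eqF //; lia.
by case: eqP => // ne_tk; rewrite entry_out // /unbump; lia.
Qed.

Lemma g_add3 A k : mxidx A <= k -> k <= tag A -> nonzero_above A k (tag A) ->
  tag (g A k) = (tag A).+1 /\ forall s t, entry (g A k) s t = add3_entry A k s t.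
Proof.
case: A => d M /= le_i le_kd nz_d; rewrite /g ltnNge; have -> /= : mxindex M <= k by [].
rewrite (ltn_eqF (le_kd : k < d.+1)); split=> // s t.
case: (boolP ((s <= d.+1) && (t <= d.+1))) => [/andP[le_s le_t]|out].
  by rewrite entry_add3 ?inordK //= ?ltnS 1?ltnW.
rewrite negb_and -!ltnNge in out.
by rewrite entry_out // add3_entry_out.
Qed.

(** * Sums over rows and columns *)

Arguments iota : simpl never.

Lemma iota_cat k d : k <= d -> iota 0 d.+1 = iota 0 k ++ iota k (d.+1 - k).
Proof. by move=> le_kd; rewrite -[iota k _]/(iota (0 + k) _) -iotaD subnKC // ltnW. Qed.

(** The range of the new rows or columns when one is inserted at [k]. *)
Lemma iota_insert k d : k <= d ->
  iota 0 d.+2 = iota 0 k ++ k :: map S (iota k (d.+1 - k)).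
Proof.
move=> le_kd; rewrite -(iotaDl 1 k) -[k :: _]/(iota (0 + k) _.+1) -iotaD.
by congr iota; lia.
Qed.

Lemma sum_support V m f : uniq V -> (forall t, t \in V -> t < m) ->
  (forall t, t \notin V -> f t = 0) ->
  \sum_(t <- iota 0 m) f t = \sum_(t <- V) f t.
Proof.
move=> UV V_lt f0; rewrite (bigID (mem V)) /= [X in _ + X]big1 => [|t /f0 //].
rewrite addn0 -big_filter; apply: perm_big; apply: uniq_perm => // [|t].
  by rewrite filter_uniq ?iota_uniq.
rewrite mem_filter mem_iota; apply/andP/idP => [[]//|tV].
by split=> //; rewrite V_lt.
Qed.

Definition row_sum (A : sqmx) (s : nat) :
  nat := \sum_(t <- iota 0 (tag A).+1) entry A s t.
Definition mx_sum (A : sqmx) : nat := \sum_(s <- iota 0 (tag A).+1) row_sum A s.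
Definition diag_count (A : sqmx) : nat :=
  count (fun s => entry A s s != 0) (iota 0 (tag A).+1).

Lemma iota_rcons d : iota 0 d.+1 = rcons (iota 0 d) d.
Proof. by rewrite -addn1 iotaD cats1. Qed.

Lemma row_sum_out A s : tag A < s -> row_sum A s = 0.
Proof. by move=> lt_s; rewrite /row_sum big1 // => t _; rewrite entry_out ?lt_s. Qed.

(** * Effect of each addition rule *)

Section Addition.
Variables (A : sqmx) (i : nat).
Hypotheses (fA : is_fishburn A).
Let B := g A i.

Let tri s t : t < s -> entry A s t = 0. Proof. by case: fA => H _ _; apply: H. Qed.

Section Add1.
Hypothesis (lt_i : i < mxidx A).

Let le_i : i <= tag A.
Proof. by case: (is_fishburn_last fA) => j le_j [Ej _ _]; move: lt_i;
  rewrite Ej ltnS => /leq_trans->. Qed.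

Let tagB : tag B = tag A. Proof. by have [] := g_add1 lt_i le_i. Qed.
Let entB s t : entry B s t = entry A s t + ((s == i) && (t == tag A)).
Proof. by have [_] := g_add1 lt_i le_i. Qed.

Let lastA s : s < i -> entry A s (tag A) = 0.
Proof.
by case: (is_fishburn_last fA) => j _ [Ej _ z] lt_si; apply: z; move: lt_i;
  rewrite Ej ltnS; apply: leq_trans.
Qed.

Lemma add1_last : entry B i (tag B) != 0 /\ forall s, s < i -> entry B s (tag B) = 0.
Proof.
rewrite tagB; split=> [|s lt_si]; rewrite entB ?eqxx ?addn1 //.
by rewrite lastA // (ltn_eqF lt_si).
Qed.

Lemma add1_is_fishburn : is_fishburn B.
Proof.
case: fA => _ rows cols; split=> [s t lt_ts|s|t]; rewrite ?tagB.
- by rewrite entB tri //; apply/eqP; rewrite eqb0; apply/andP => -[/eqP Es /eqP Et];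
  lia.
- by move/rows => [t nz]; exists t; rewrite entB addn_eq0 (negPf nz).
by move/cols => [s nz]; exists s; rewrite entB addn_eq0 (negPf nz).
Qed.

Lemma add1_row_sum s : row_sum B s = row_sum A s + (s == i).
Proof.
rewrite /row_sum tagB (eq_bigr _ (fun t _ => entB s t)) big_split /=; congr (_ + _).
rewrite iota_rcons -cats1 big_cat big_seq1 eqxx andbT big_seq big1 // => t.
by rewrite mem_iota => /andP[_ /ltn_eqF->]; rewrite andbF.
Qed.

Lemma add1_mx_sum : mx_sum B = (mx_sum A).+1.
Proof.
rewrite /mx_sum tagB (eq_bigr _ (fun s _ => add1_row_sum s)) big_split /=.
rewrite -[RHS]addn1; congr (_ + _);
  rewrite (sum_support (V := [:: i])) ?big_seq1 ?eqxx //.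
  by move=> t; rewrite inE => /eqP->.
by move=> t; rewrite inE => /negPf->.
Qed.

(** The increased cell can only be on the diagonal as the bottom right cell,
    when the index is the dimension; then it was nonzero already. *)
Lemma add1_diag_count : diag_count B = diag_count A.
Proof.
rewrite /diag_count tagB; apply: eq_count => s; rewrite entB.
case: (s =P i) => [->|_]; last by rewrite addn0.
case: (i =P tag A) => [Ei|_]; last by rewrite addn0.
rewrite Ei addn1 /=.
case: (is_fishburn_last fA) => j le_j [Ej nz _]; move: lt_i;
  rewrite Ej ltnS Ei => le_dj.
by have/eqP Ejd : j == tag A; [rewrite eqn_leq le_j | rewrite -{1}Ejd nz].
Qed.

Lemma add1_record j : j < i -> row_record (entry B) j <-> row_record (entry A) j.
Proof.
have E s t : s < i -> entry B s t = entry A s t.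
  by move=> lt_si; rewrite entB (ltn_eqF lt_si) addn0.
by move=> lt_ji; apply: eq_row_record => s t le_sj; apply: E;
  apply: leq_ltn_trans lt_ji.
Qed.

End Add1.

Section Add2.
Hypothesis (Ei : i = (tag A).+1).

Let le_i := mxidx_le_dim fA.

Let tagB : tag B = (tag A).+1. Proof. by rewrite /B Ei; have [] := g_add2 le_i. Qed.
Let entB s t : entry B s t = entry A s t + ((s == (tag A).+1) && (t == (tag A).+1)).
Proof. by rewrite /B Ei; have [_] := g_add2 le_i. Qed.

Lemma add2_last : entry B i (tag B) != 0 /\ forall s, s < i -> entry B s (tag B) = 0.
Proof.
rewrite tagB Ei; split=> [|s lt_si]; rewrite entB ?eqxx ?addn1 //.
by rewrite entry_out ?ltnSn ?orbT // (ltn_eqF lt_si).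
Qed.

Lemma add2_is_fishburn : is_fishburn B.
Proof.
case: fA => _ rows cols; split=> [s t lt_ts|s|t]; rewrite ?tagB.
- by rewrite entB tri //; apply/eqP; rewrite eqb0; apply/andP => -[/eqP Es /eqP Et];
  lia.
- rewrite leq_eqVlt => /orP[/eqP->|/rows[t nz]].
    by exists (tag A).+1; rewrite entB !eqxx addn1.
  by exists t; rewrite entB addn_eq0 (negPf nz).
rewrite leq_eqVlt => /orP[/eqP->|/cols[s nz]].
  by exists (tag A).+1; rewrite entB !eqxx addn1.
by exists s; rewrite entB addn_eq0 (negPf nz).
Qed.

Lemma add2_row_sum s : row_sum B s = row_sum A s + (s == i).
Proof.
rewrite /row_sum tagB (eq_bigr _ (fun t _ => entB s t)) big_split /= iota_rcons -cats1.
rewrite !big_cat /= !big_seq1 eqxx andbT Ei [entry A _ _.+1]entry_out ?ltnSn ?orbT //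
  addn0.
congr (_ + _); rewrite big_seq big1 // => t.
by rewrite mem_iota => /andP[_ /ltn_eqF->]; rewrite andbF.
Qed.

Lemma add2_mx_sum : mx_sum B = (mx_sum A).+1.
Proof.
rewrite /mx_sum tagB (eq_bigr _ (fun s _ => add2_row_sum s)) big_split /=.
rewrite iota_rcons -cats1 !big_cat /= !big_seq1 (row_sum_out (ltnSn _)) Ei eqxx addn0
  -[RHS]addn1.
congr (_ + _); rewrite big_seq big1 // => s.
by rewrite mem_iota => /andP[_ /ltn_eqF->].
Qed.

Lemma add2_diag_count : diag_count B = (diag_count A).+1.
Proof.
rewrite /diag_count tagB iota_rcons -cats1 count_cat [count _ [:: _]]/= entB !eqxx.
rewrite [entry A _ _ + _]addn1 addn0 addn1.
congr _.+1; apply: eq_in_count => s; rewrite mem_iota => /andP[_ lt_s].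
by rewrite entB (ltn_eqF lt_s) addn0.
Qed.

Lemma add2_record j : j < i -> row_record (entry B) j <-> row_record (entry A) j.
Proof.
have E s t : s < i -> entry B s t = entry A s t.
  by rewrite Ei => lt_si; rewrite entB (ltn_eqF lt_si) addn0.
by move=> lt_ji; apply: eq_row_record => s t le_sj; apply: E;
  apply: leq_ltn_trans lt_ji.
Qed.

End Add2.

Section Add3.
Hypotheses (ge_i : mxidx A <= i) (le_i : i <= tag A).

(** The index being at most [i], the topmost nonzero cell of the last column is
    above the new row. *)
Lemma nonzero_above_last : nonzero_above A i (tag A).
Proof.
by case: (is_fishburn_last fA) => j le_j [Ej nz _]; apply/nonzero_aboveP; exists j;
  rewrite // -Ej.
Qed.

Let p := nonzero_above A i.
Let d := tag A.
Let tagB : tag B = d.+1. Proof. by have [] := g_add3 ge_i le_i nonzero_above_last. Qed.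
Let entB s t : entry B s t = add3_entry A i s t.
Proof. by have [_ ->] := g_add3 ge_i le_i nonzero_above_last. Qed.

Lemma entry_top_out s u : s < i -> u \notin old_cols p i d -> entry A s u = 0.
Proof.
move=> lt_si; rewrite mem_old_cols // negb_or => /andP[ne_u H].
case: (ltngtP u d) => [lt_ud|lt_du|Eu]; last by rewrite Eu eqxx in ne_u.
  by move: H; rewrite lt_ud; apply: nonzero_above0.
by rewrite entry_out // lt_du orbT.
Qed.

Let entB_top s t : s < i ->
  entry B s t = transport (old_cols p i d) (new_cols p i d) (entry A s) t.
Proof. by move=> lt_si; rewrite entB /add3_entry lt_si. Qed.

Let entB_mid t : entry B i t = (t == d.+1).
Proof. by rewrite entB /add3_entry ltnn eqxx. Qed.

Let entB_low s t : i <= s ->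
  entry B s.+1 t = if t == i then 0 else entry A s (unbump i t).
Proof.
by move=> le_is; rewrite entB /add3_entry ltnNge leqW //= gtn_eqF.
Qed.

Let uvE := size_cols p i d.
Let sU : sorted ltn (old_cols p i d). Proof. exact: sorted_old_cols. Qed.
Let sV : sorted ltn (new_cols p i d). Proof. exact: sorted_new_cols. Qed.
Let UU : uniq (old_cols p i d). Proof. exact: sorted_uniq ltn_trans ltnn _ sU. Qed.
Let UV : uniq (new_cols p i d). Proof. exact: sorted_uniq ltn_trans ltnn _ sV. Qed.

Let entB_left s t : s < i -> t < i -> entry B s t = entry A s t.
Proof.
move=> lt_si lt_ti; rewrite entB_top //.
by apply: (transport_ltk le_i lt_ti _).1 => u _; apply: nonzero_above0.
Qed.

Lemma add3_last : entry B i (tag B) != 0 /\ forall s, s < i -> entry B s (tag B) = 0.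
Proof.
rewrite tagB; split=> [|s lt_si]; first by rewrite entB_mid eqxx.
by rewrite entB_top // /transport ifF // mem_new_cols //; lia.
Qed.

Let topB t : t \in new_cols p i d -> exists2 s, s < i & entry B s t != 0.
Proof.
move=> tV; have uU : nth 0 (old_cols p i d) (index t (new_cols p i d))
  \in old_cols p i d.
  by rewrite mem_nth // uvE index_mem.
have /nonzero_aboveP[s lt_si nz] :
  p (nth 0 (old_cols p i d) (index t (new_cols p i d))).
  by move: uU; rewrite mem_old_cols // => /orP[/eqP->|/andP[_ //]];
    apply: nonzero_above_last.
by exists s => //; rewrite entB_top // /transport tV.
Qed.

(** The label and the new matrix determine which columns were nonzero: this is
    what makes the third rule reversible. *)
Lemma add3_nonzero_above t : nonzero_above B i t = (t \in new_cols p i d).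
Proof.
apply/nonzero_aboveP/idP => [[s lt_si]|/topB[s]]; last by exists s.
by rewrite entB_top // /transport; case: ifP.
Qed.

Lemma add3_is_fishburn : is_fishburn B.
Proof.
case: fA => _ rows cols; split=> [s t lt_ts|s|t]; rewrite ?tagB.
- case: (ltngtP s i) => [lt_si|lt_is|Es].
  + by rewrite entB_left ?tri // (ltn_trans lt_ts).
  + case: s lt_is lt_ts => // s lt_is lt_ts; rewrite entB_low //.
    by case: eqP => // ne_ti; apply: tri; rewrite /unbump; lia.
  by rewrite Es entB_mid; apply/eqP; rewrite eqb0; lia.
- case: (ltngtP s i) => [lt_si _|lt_is|-> _].
  + have [u nz] := rows s (ltnW (leq_trans lt_si le_i)).
    have uU : u \in old_cols p i d by apply: contraR nz => /(entry_top_out lt_si)->.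
    have [t _ Et] := transport_neq0 UV uvE uU nz.
    by exists t; rewrite entB_top // Et.
  + case: s lt_is => // s lt_is; rewrite ltnS => /rows[u nz].
    by exists (bump i u);
      rewrite entB_low // (eq_sym (bump _ _)) (negPf (neq_bump _ _)) bumpK.
  by exists d.+1; rewrite entB_mid eqxx.
move=> le_t; case: (boolP (t \in new_cols p i d)) => [/topB[s _ nz]|];
  first by exists s.
rewrite mem_new_cols //; case: (ltngtP t i) => [lt_ti|lt_it|//] /=; rewrite ?orbF => H.
  have [s nz] := cols t (ltnW (leq_trans lt_ti le_i)).
  exists s; case: (ltnP s i) => [lt_si|le_is];
    last by rewrite tri ?(leq_trans lt_ti) in nz.
  by rewrite entB_left.
move: le_t; rewrite leq_eqVlt => /orP[/eqP->|lt_td].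
  by exists i; rewrite entB_mid eqxx.
have [|s nz] := cols t.-1; first by lia.
exists s.+1; rewrite entB_low.
  by rewrite (gtn_eqF lt_it) /unbump lt_it subn1.
rewrite leqNgt; apply/negP => lt_si; case/negP: H; rewrite -ltnS lt_td.
by apply/nonzero_aboveP; exists s.
Qed.

Lemma add3_row_sum s : row_sum B s =
  if s < i then row_sum A s else if s == i then 1 else row_sum A s.-1.
Proof.
rewrite /row_sum tagB; case: (ltngtP s i) => [lt_si|lt_is|->].
- rewrite (eq_bigr _ (fun t _ => entB_top t lt_si)).
  rewrite (sum_support (V := new_cols p i d)) //; first last.
  + by move=> t /negPf tV; rewrite /transport tV.
  + by move=> t; rewrite mem_new_cols //; lia.
  rewrite transport_sum // (sum_support (V := old_cols p i d)) //.
    by move=> u; rewrite mem_old_cols //; lia.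
  by move=> u; apply: entry_top_out.
- case: s lt_is => // s lt_is; rewrite (iota_insert le_i) (iota_cat le_i).
  rewrite !big_cat big_cons big_map entB_low // eqxx /= add0n; congr (_ + _).
    apply: eq_big_seq => t; rewrite mem_iota => /andP[_ lt_ti].
    by rewrite entB_low // (ltn_eqF lt_ti) /unbump ltnNge ltnW // subn0.
  apply: eq_big_seq => t; rewrite mem_iota => /andP[le_it _].
  by rewrite entB_low // gtn_eqF // /unbump ltnS le_it subn1.
rewrite (sum_support (V := [:: d.+1])) // ?big_seq1 ?entB_mid ?eqxx //.
  by move=> t; rewrite inE => /eqP->.
by move=> t; rewrite inE entB_mid => /negPf->.
Qed.

Lemma add3_mx_sum : mx_sum B = (mx_sum A).+1.
Proof.
rewrite /mx_sum tagB (iota_insert le_i) (iota_cat le_i) !big_cat big_cons big_map /=.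
rewrite add3_row_sum ltnn eqxx add1n addnS; congr (_ + _).+1; apply: eq_big_seq => s.
  by rewrite mem_iota add3_row_sum => /andP[_ ->].
by rewrite mem_iota add3_row_sum => /andP[le_is _]; rewrite ltnNge leqW //= gtn_eqF.
Qed.

Lemma add3_diag_count : diag_count B = diag_count A.
Proof.
rewrite /diag_count tagB (iota_insert le_i) (iota_cat le_i) !count_cat /= count_map.
rewrite entB_mid (ltn_eqF (le_i : i < d.+1)) add0n; congr (_ + _).
  by apply: eq_in_count => s; rewrite mem_iota => /andP[_ lt_si]; rewrite entB_left.
apply: eq_in_count => s; rewrite mem_iota => /andP[le_is _] /=.
by rewrite entB_low // (gtn_eqF (le_is : i < s.+1)) /unbump ltnS le_is subn1.
Qed.

Lemma add3_record j : j < i -> row_record (entry B) j <-> row_record (entry A) j.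
Proof.
move=> lt_ji; have lt_si s : s <= j -> s < i by move/leq_ltn_trans; apply.
split; [apply: (row_record_transport sU sV uvE) | apply: (row_record_transport sV sU
  (esym uvE))].
- by move=> s t /lt_si /entB_top.
- by move=> s u /lt_si lt_s; apply: entry_top_out.
- move=> s t /lt_si lt_s.
  rewrite (eq_transport (esym uvE) (g := transport (old_cols p i d) (new_cols p i d)
    (entry A s))).
    by rewrite transportK // => u; apply: entry_top_out.
  by move=> u _; apply: entB_top.
by move=> s t /lt_si lt_s tV; rewrite entB_top // /transport (negPf tV).
Qed.

Lemma add3_lastcol j : i < j -> entry B j (tag B) = entry A j.-1 (tag A).
Proof.
case: j => // j lt_ij; rewrite tagB entB_low // gtn_eqF ?ltnS //.
by rewrite /unbump ltnS le_i subn1.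
Qed.

End Add3.
End Addition.

(** * Effect of an addition on index, dimension and statistics *)

Section Summary.
Variables (A : sqmx) (i : nat).
Hypotheses (fA : is_fishburn A) (le_i : i <= (tag A).+1).
Let B := g A i.

Lemma g_cases : [\/ i < mxidx A, i = (tag A).+1 | mxidx A <= i /\ i <= tag A].
Proof.
case: (ltnP i (mxidx A)) => [|ge_i]; first by constructor 1.
move: le_i; rewrite leq_eqVlt => /orP[/eqP|]; first by constructor 2.
by constructor 3.
Qed.

Let mxidx_le := mxidx_le_dim fA.

Lemma g_is_fishburn : is_fishburn B.
Proof.
case: g_cases => [lt_i|Ei|[ge_i le_it]].
- exact: add1_is_fishburn.
- exact: add2_is_fishburn.
- exact: add3_is_fishburn.
Qed.

(** Under each rule, row [i] has the topmost nonzero cell of the last column. *)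
Lemma g_last : entry B i (tag B) != 0 /\ forall s, s < i -> entry B s (tag B) = 0.
Proof.
case: g_cases => [lt_i|Ei|[ge_i le_it]].
- exact: add1_last.
- exact: add2_last.
- exact: add3_last.
Qed.

Lemma g_mxidx : mxidx B = i.+1.
Proof. by have [nz z] := g_last; apply: mxidx_eq. Qed.

Lemma g_mx_sum : mx_sum B = (mx_sum A).+1.
Proof.
case: g_cases => [lt_i|Ei|[ge_i le_it]].
- exact: add1_mx_sum.
- exact: add2_mx_sum.
- exact: add3_mx_sum.
Qed.

Lemma g_tag : tag B = tag A + (mxidx A <= i).
Proof.
rewrite /B; case: g_cases => [lt_i|Ei|[ge_i le_it]].
- rewrite leqNgt lt_i addn0; have [j _ [Ej _ _]] := is_fishburn_last fA.
  by have [||-> _] := @g_add1 A i; rewrite // -ltnS (leq_trans lt_i).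
- by rewrite Ei mxidx_le addn1; have [-> _] := g_add2 mxidx_le.
by rewrite ge_i addn1; have [|-> _] := g_add3 ge_i le_it;
  first exact: nonzero_above_last.
Qed.

Lemma g_diag_count : diag_count B = diag_count A + (i == (tag A).+1).
Proof.
case: g_cases => [lt_i|Ei|[ge_i le_it]].
- by rewrite [LHS]add1_diag_count // ltn_eqF ?addn0 // (leq_trans lt_i).
- by rewrite [LHS]add2_diag_count // Ei eqxx addn1.
by rewrite [LHS]add3_diag_count // ltn_eqF ?addn0 // ltnS.
Qed.

(** The third rule keeps the row sums above the new row, and the first row is
    above it since the index is positive. *)
Lemma g_row0 : row_sum B 0 = row_sum A 0 + (i == 0).
Proof.
case: g_cases => [lt_i|Ei|[ge_i le_it]].
- by rewrite [LHS]add1_row_sum // eq_sym.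
- by rewrite [LHS]add2_row_sum // eq_sym.
have lt_0i : 0 < i by apply: leq_trans ge_i.
by rewrite [LHS]add3_row_sum // lt_0i gtn_eqF ?addn0.
Qed.

(** The counterpart of [LRmax_profile_insert]. *)
Lemma g_lastcol j : entry B j (tag B) =
  if i < mxidx A then entry A j (tag A) + (j == i)
  else if j < i then 0 else if j == i then 1 else entry A j.-1 (tag A).
Proof.
have [_ z] := g_last; case: g_cases => [lt_i|Ei|[ge_i le_it]].
- rewrite lt_i /B; have [j' _ [Ej _ _]] := is_fishburn_last fA.
  have le_it : i <= tag A by rewrite -ltnS (leq_trans lt_i).
  by have [-> ->] := g_add1 lt_i le_it; rewrite eqxx andbT.
- rewrite Ei ltnNge mxidx_le -Ei; case: ltngtP => [/z //|lt_ij|->].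
    rewrite /= (@entry_out A); last by lia.
    by rewrite entry_out // g_tag; lia.
  rewrite /B Ei; have [-> ->] := g_add2 mxidx_le.
  by rewrite !eqxx entry_out // ltnSn.
rewrite ltnNge ge_i /=; case: ltngtP => [/z //|lt_ij|->].
  exact: add3_lastcol.
rewrite /B; have [|-> ->] := g_add3 ge_i le_it; first exact: nonzero_above_last.
by rewrite /add3_entry ltnn !eqxx.
Qed.

(** The counterpart of [RLmax_profile_insert].  By [g_last] the cell [i] of the
    last column is north-east of everything below row [i], so no row below [i]
    has a record; the rows above keep theirs. *)
Lemma g_record j : row_record (entry B) j <-> (if j < i then row_record (entry A) j
  else j = i).
Proof.
have [nz z] := g_last; case: (ltngtP j i) => [lt_ji|lt_ij|->].
- case: g_cases => [lt_i|Ei|[ge_i le_it]].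
  + exact: add1_record.
  + exact: add2_record.
  + exact: add3_record.
- split=> [[t nzj zj]|Eji]; last by rewrite Eji ltnn in lt_ij.
  have /andP[_ le_t] := entry_bound nzj.
  by rewrite (zj i (tag B) lt_ij le_t) in nz.
split=> // _; exists (tag B) => // s t lt_si.
by rewrite leq_eqVlt => /orP[/eqP<-|lt_t]; [apply: z | rewrite entry_out ?lt_t ?orbT].
Qed.

End Summary.

(** * The addition is injective *)

Lemma row_sum_gt0 A s : is_fishburn A -> s <= tag A -> 0 < row_sum A s.
Proof.
case=> _ rows _ /rows[t nz]; have /andP[_ le_t] := entry_bound nz.
rewrite lt0n /row_sum; apply: contra nz => /eqP H.
move: H; rewrite (big_rem t) ?mem_iota ?ltnS //= => /eqP.
by rewrite addn_eq0 => /andP[].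
Qed.

Lemma eq_old_cols p p' k d : k <= d -> (forall u, u < d -> p u = p' u) ->
  old_cols p k d = old_cols p' k d.
Proof.
move=> le_kd Ep; rewrite /old_cols; congr (_ ++ rcons _ _); apply: eq_in_filter => u.
  by rewrite mem_iota => /andP[_ lt_u]; apply: Ep; apply: leq_trans le_kd.
by rewrite mem_iota subnKC // => /andP[_ /Ep].
Qed.

Lemma eq_new_cols p p' k d : k <= d -> (forall u, u < d -> p u = p' u) ->
  new_cols p k d = new_cols p' k d.
Proof.
move=> le_kd Ep; rewrite /new_cols; congr (_ ++ _ :: [seq x.+1 | x <- _]);
  apply: eq_in_filter => u.
  by rewrite mem_iota => /andP[_ lt_u]; apply: Ep; apply: leq_trans le_kd.
by rewrite mem_iota subnKC // => /andP[_ /Ep].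
Qed.

(** The columns of the smaller matrix that are nonzero above row [k], read off
    from the larger one: on columns other than the last, the two lists of
    columns differ by the inserted column only. *)
Definition old_nonzero_above (B : sqmx) (k u : nat) : bool :=
  nonzero_above B k (if u < k then u else u.+1).

Definition undo_add3_entry (B : sqmx) (k s u : nat) : nat :=
  let d := (tag B).-1 in
  if s < k then
    transport (new_cols (old_nonzero_above B k) k d) (old_cols (old_nonzero_above B
      k) k d) (entry B s) u
  else entry B s.+1 (bump k u).

Lemma add3K A i s u : is_fishburn A -> mxidx A <= i -> i <= tag A ->
  entry A s u = undo_add3_entry (g A i) i s u.
Proof.
move=> fA ge_i le_i; have nz := nonzero_above_last fA ge_i.
have [Et Ee] := g_add3 ge_i le_i nz; rewrite /undo_add3_entry Et /=.
case: (ltnP s i) => [lt_si|le_is]; last first.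
  by rewrite Ee /add3_entry ltnNge leqW //= (gtn_eqF (le_is :
    i < s.+1)) (eq_sym (bump _ _)) (negPf (neq_bump _ _)) bumpK.
have Ep v : v < tag A -> old_nonzero_above (g A i) i v = nonzero_above A i v.
  rewrite /old_nonzero_above add3_nonzero_above // mem_new_cols // => lt_v;
    case: (ltnP v i) => [lt_vi|le_iv].
    by rewrite lt_vi (ltn_eqF lt_vi) [i < v]ltnNge (ltnW lt_vi) /= orbF.
  have -> : (v.+1 < i) = false by lia.
  have -> : (v.+1 == i) = false by lia.
  by rewrite /= ltnS le_iv lt_v.
rewrite (eq_new_cols le_i Ep) (eq_old_cols le_i Ep).
have UU := sorted_uniq ltn_trans ltnn (sorted_old_cols (nonzero_above A i) le_i).
have UV := sorted_uniq ltn_trans ltnn (sorted_new_cols (nonzero_above A i) le_i).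
have E := size_cols (nonzero_above A i) i (tag A).
rewrite (eq_transport (esym E)
  (g := transport (old_cols (nonzero_above A i) i (tag A)) (new_cols (nonzero_above A
    i) i (tag A)) (entry A s))).
  by rewrite transportK // => v; apply: entry_top_out.
by move=> v _; rewrite Ee /add3_entry lt_si.
Qed.

(** The index gives [i].  Row [i] of the new matrix has weight 1 under the second
    and third rules, but more under the first, where it was nonzero before;
    the second rule is the one with [i] maximal.  Each rule is then undone. *)
Lemma g_inj A1 A2 i1 i2 : is_fishburn A1 -> is_fishburn A2 ->
  i1 <= (tag A1).+1 -> i2 <= (tag A2).+1 -> g A1 i1 = g A2 i2 ->
  A1 = A2 /\ i1 = i2.
Proof.
move=> f1 f2 le1 le2 Eg.
have Ei : i1 = i2.
  by apply: succn_inj; rewrite -(g_mxidx f1 le1) -(g_mxidx f2 le2) Eg.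
split=> //; rewrite -{i2}Ei in le2 Eg *; set i := i1 in le1 le2 Eg *.
have rowB A : is_fishburn A -> i <= (tag A).+1 ->
  (i < mxidx A) = (1 < row_sum (g A i) i).
  move=> fA le_i; case: (g_cases le_i) => [lt_i|Ei|[ge_i le_it]].
  - have [j le_j [Ej _ _]] := is_fishburn_last fA;
    rewrite lt_i add1_row_sum // eqxx addn1 ltnS.
    by rewrite row_sum_gt0 //; apply: leq_trans le_j; move: lt_i; rewrite Ej ltnS.
  - rewrite add2_row_sum // eqxx addn1 row_sum_out ?Ei //.
    by rewrite ltnNge mxidx_le_dim.
  by rewrite ltnNge ge_i add3_row_sum // ltnn eqxx.
have lt12 : (i < mxidx A1) = (i < mxidx A2) by rewrite !rowB // Eg.
have tag12 : tag A1 = tag A2.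
  have := g_tag f1 le1; have := g_tag f2 le2.
  by rewrite -Eg => -> /eqP; rewrite ![_ <= i]leqNgt lt12 eqn_add2r => /eqP.
apply: sqmx_eq => // s t _ _.
case: (g_cases le1) => [lt1|E1|[ge1 le1']].
- have lt2 : i < mxidx A2 by rewrite -lt12.
  have le_t A : is_fishburn A -> i < mxidx A -> i <= tag A.
    by move=> fA; have [j le_j [-> _ _]] := is_fishburn_last fA;
      rewrite ltnS => /leq_trans; apply.
  have [_ E1] := g_add1 lt1 (le_t _ f1 lt1); have [_ E2] := g_add1 lt2 (le_t _ f2 lt2).
  by have := E1 s t; rewrite Eg E2 tag12 => /addIn.
- have [_ H1] := g_add2 (mxidx_le_dim f1); have [_ H2] := g_add2 (mxidx_le_dim f2).
  by have := H1 s t; rewrite -E1 Eg E1 tag12 H2 => /addIn.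
have ge2 : mxidx A2 <= i by rewrite leqNgt -lt12 -leqNgt.
have le2' : i <= tag A2 by rewrite -tag12.
by rewrite (add3K s t f1 ge1 le1') (add3K s t f2 ge2 le2') Eg.
Qed.

(** * The addition is surjective *)

Lemma is_fishburn_diag_last B : is_fishburn B -> entry B (tag B) (tag B) != 0.
Proof.
case=> tri rows _; have [t nz] := rows _ (leqnn _).
have /andP[_ le_t] := entry_bound nz; move: le_t nz; rewrite leq_eqVlt.
by case/orP=> [/eqP-> //|lt_t]; rewrite tri.
Qed.

Lemma leq_mxidx A k : is_fishburn A -> nonzero_above A k (tag A) -> mxidx A <= k.
Proof.
move=> fA /nonzero_aboveP[s lt_sk nz]; have [j _ [-> _ z]] := is_fishburn_last fA.
by apply: leq_ltn_trans lt_sk; rewrite leqNgt; apply/negP => /z E; rewrite E in nz.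
Qed.

Lemma entry_mx_of_fun_out d f s t : (d < s) || (d < t) -> entry (mx_of_fun d f) s t = 0.
Proof. exact: (@entry_out (mx_of_fun d f)). Qed.

Lemma row_sum_split B s :
  row_sum B s = \sum_(t <- iota 0 (tag B)) entry B s t + entry B s (tag B).
Proof. by rewrite /row_sum iota_rcons -cats1 big_cat big_seq1. Qed.

Section Removal.
Variables (B : sqmx) (k : nat).
Hypotheses (fB : is_fishburn B) (le_k : k <= tag B).
Hypotheses (nzB : entry B k (tag B) != 0) (zB :
  forall s, s < k -> entry B s (tag B) = 0).
Let D := tag B.

Let tri s t : t < s -> entry B s t = 0. Proof. by case: fB => H _ _; apply: H. Qed.

(** The decreased cell may become zero: its row stays nonzero by its weight, and
    its column thanks to the bottom right cell. *)
Lemma undo_add1 : 1 < row_sum B k ->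
  exists2 A, is_fishburn A & k <= (tag A).+1 /\ g A k = B.
Proof.
move=> gt1; pose f s t := entry B s t - ((s == k) && (t == D)).
pose A := mx_of_fun D f.
have EA s t : entry A s t = f s t.
  case: (boolP ((s <= D) && (t <= D))) => [/andP[le_s le_t]|];
    first exact: entry_mx_of_fun.
  rewrite negb_and -!ltnNge => out; rewrite entry_mx_of_fun_out // /f entry_out //.
have fA : is_fishburn A.
  case: fB => _ rows cols; split=> [s t lt_ts|s le_s|t le_t].
  - by rewrite EA /f tri.
  - have [t nz] := rows s le_s; case: (eqVneq s k) => [Es|ne_sk]; last first.
      by exists t; rewrite EA /f (negPf ne_sk) subn0.
    case: (ltnP 1 (entry B k D)) => [lt1|le1].
      by exists D; rewrite EA /f Es !eqxx subn1 -lt0n -ltnS prednK // ltnW.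
    have /hasP[u] : has (fun u => entry B k u != 0) (iota 0 D).
      apply: contraLR gt1 => /hasPn H;
        rewrite -leqNgt row_sum_split big_seq big1 // => u.
      by move/H; rewrite negbK => /eqP.
    rewrite mem_iota => /andP[_ lt_u] nzu; exists u.
    by rewrite EA /f (ltn_eqF lt_u) andbF subn0 Es.
  have [s nz] := cols t le_t; case: (eqVneq t D) => [Et|ne_tD]; last first.
    by exists s; rewrite EA /f (negPf ne_tD) andbF subn0.
  exists D; rewrite EA /f Et eqxx andbT; have nzD := is_fishburn_diag_last fB.
  case: (eqVneq D k) => [Ek|_]; last by rewrite subn0.
  have : row_sum B k = entry B D D.
    rewrite row_sum_split -Ek big_seq big1 // => u.
    by rewrite mem_iota => /andP[_ lt_u]; apply: tri.
  by rewrite -Ek in gt1 *; move=> E; rewrite E in gt1; rewrite -lt0n subn_gt0.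
exists A => //; have lt_k : k < mxidx A.
  have [j _ [-> nz _]] := is_fishburn_last fA; rewrite ltnS leqNgt; apply/negP => lt_jk.
  by rewrite EA /f zB in nz.
split; first exact: leqW.
have [Et Ee] := g_add1 lt_k (le_k : k <= tag A).
apply: sqmx_eq => [|s t _ _]; first by rewrite Et.
rewrite Ee EA /f; case: (boolP (_ && _)) => [/andP[/eqP-> /eqP->]|_];
  last by rewrite subn0 addn0.
by rewrite subnK // lt0n.
Qed.

Hypothesis row1 : row_sum B k = 1.

(** The only nonzero cell of row [k] is then the one in the last column. *)
Lemma row_single t : entry B k t = (t == D).
Proof.
have [H1 H2] : \sum_(t <- iota 0 D) entry B k t = 0 /\ entry B k D = 1.
  by move: row1; rewrite row_sum_split -/D; move: nzB; rewrite -/D; lia.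
case: (ltngtP t D) => [lt_t|lt_t|-> //]; last by rewrite entry_out ?lt_t ?orbT.
move/eqP: H1; rewrite (big_rem t) ?mem_iota //= addn_eq0 => /andP[/eqP-> _].
by [].
Qed.

Lemma undo_add2 d : D = d.+1 -> k = D ->
  exists2 A, is_fishburn A & k <= (tag A).+1 /\ g A k = B.
Proof.
move=> Dd kD; pose A := mx_of_fun d (entry B).
have EA s t : s <= d -> t <= d -> entry A s t = entry B s t by apply: entry_mx_of_fun.
have fA : is_fishburn A.
  case: fB => _ rows cols; split=> [s t lt_ts|s le_s|t le_t].
  - case: (leqP s d) => [le_s|lt_s]; last by rewrite entry_mx_of_fun_out ?lt_s.
    by rewrite EA ?tri // ltnW // (leq_trans lt_ts).
  - have [|t nz] := rows s; first by rewrite -/D Dd leqW.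
    exists t; rewrite EA //; have /andP[_] := entry_bound nz.
    rewrite -/D leq_eqVlt Dd ltnS => /orP[/eqP Et|//].
    by move: nz; rewrite Et -Dd zB // kD Dd ltnS.
  have [|s nz] := cols t; first by rewrite -/D Dd leqW.
  exists s; rewrite EA //; apply: leq_trans le_t.
  by rewrite leqNgt; apply/negP => /tri E; rewrite E in nz.
exists A => //; have Ek : k = (tag A).+1 by rewrite kD Dd.
split; first by rewrite Ek.
have [Et Ee] := g_add2 (mxidx_le_dim fA); rewrite Ek.
apply: sqmx_eq => [|s t le_s le_t]; first by rewrite Et -Ek.
rewrite Ee; rewrite Et in le_s le_t; rewrite -Ek in le_s le_t *.
case: (ltngtP s k) le_s => // [lt_s|->] _ /=.
  rewrite addn0; case: (ltngtP t k) le_t => // [lt_t|->] _.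
    by rewrite EA // -ltnS -Dd -kD.
  rewrite kD (zB lt_s : entry B s D = 0).
  by rewrite entry_mx_of_fun_out // Dd ltnSn orbT.
by rewrite row_single -kD entry_mx_of_fun_out // kD Dd ltnSn.
Qed.

(** Column [k] has no nonzero cell on or below the diagonal, hence one above row
    [k]; the last column has none there.  So [new_cols] are exactly the columns
    that are nonzero above row [k], and relabelling them back to [old_cols]
    before deleting row and column [k] gives the preimage. *)
Lemma undo_add3 d : D = d.+1 -> k <= d ->
  exists2 A, is_fishburn A & k <= (tag A).+1 /\ g A k = B.
Proof.
move=> Dd le_kd; pose p := old_nonzero_above B k.
pose U := old_cols p k d; pose V := new_cols p k d.
have sU : sorted ltn U by apply: sorted_old_cols.
have sV : sorted ltn V by apply: sorted_new_cols.
have UU := sorted_uniq ltn_trans ltnn sU; have UV := sorted_uniq ltn_trans ltnn sV.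
have UVsize : size U = size V by apply: size_cols.
have top_k : nonzero_above B k k.
  case: fB => _ _ /(_ _ le_k)[s nz]; apply/nonzero_aboveP; exists s => //.
  case: (ltngtP s k) nz => // [lt_ks|->]; first by rewrite tri.
  by rewrite row_single Dd (ltn_eqF (le_kd : k < d.+1)).
have VE t : (t \in V) = nonzero_above B k t.
  rewrite mem_new_cols // /p /old_nonzero_above;
    case: (ltngtP t k) => [lt_t|lt_t|->] /=.
  - by rewrite orbF.
  - have -> : (t.-1 < k) = false by lia.
    rewrite prednK ?(leq_ltn_trans _ lt_t) //.
    case: leqP => //= lt_dt; apply/esym/nonzero_aboveP => -[s lt_s].
    move: lt_dt; rewrite -Dd leq_eqVlt => /orP[/eqP<-|lt_D]; first by rewrite zB.
    by rewrite entry_out ?lt_D ?orbT.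
  by rewrite top_k.
pose A := mx_of_fun d (undo_add3_entry B k).
have EA s u : s <= d -> u <= d ->
  entry A s u = undo_add3_entry B k s u by apply: entry_mx_of_fun.
have EAtop s u : s < k -> entry A s u = transport V U (entry B s) u.
  move=> lt_s; case: (leqP u d) => [le_u|lt_u].
    by rewrite EA ?(leq_trans (ltnW lt_s)) // /undo_add3_entry lt_s -/D Dd.
  rewrite entry_mx_of_fun_out ?lt_u ?orbT // /transport ifF // mem_old_cols //; lia.
have EAlow s u : k <= s -> entry A s u = entry B s.+1 (bump k u).
  move=> le_ks; case: (boolP ((s <= d) && (u <= d))) => [/andP[le_s le_u]|].
    by rewrite EA // /undo_add3_entry ltnNge le_ks.
  rewrite negb_and -!ltnNge => out;
    rewrite entry_mx_of_fun_out // entry_out // -/D Dd /bump.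
  by case: leqP => /=; lia.
have topA u : nonzero_above A k u = (u \in U).
  apply/nonzero_aboveP/idP => [[s lt_s]|uU].
    by rewrite EAtop // /transport; case: ifP.
  have : nth 0 V (index u U) \in V by rewrite mem_nth // -UVsize index_mem.
  rewrite VE => /nonzero_aboveP[s lt_s nz]; exists s => //.
  by rewrite EAtop // /transport uU.
have Ep u : u < d -> nonzero_above A k u = p u.
  by move=> lt_u; rewrite topA mem_old_cols // (ltn_eqF lt_u) lt_u.
have fA : is_fishburn A.
  case: fB => _ rows cols; split=> [s u lt_us|s le_s|u le_u].
  - case: (ltnP s k) => [lt_s|le_s]; last by rewrite EAlow // tri // /bump; lia.
    have lt_uk := ltn_trans lt_us lt_s.
    rewrite EAtop // (transport_ltk le_kd lt_uk _).2 ?tri // => v lt_v.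
    by rewrite /p /old_nonzero_above lt_v; apply: nonzero_above0.
  - have [|t nz] := rows (if s < k then s else s.+1); first by have : s <= d := le_s;
    rewrite -/D Dd; case: ifP; lia.
    case: (ltnP s k) nz => [lt_s|le_ks] nz.
      have tV : t \in V by rewrite VE; apply/nonzero_aboveP; exists s.
      have [u _ Eu] := transport_neq0 UU (esym UVsize) tV nz.
      by exists u; rewrite EAtop // Eu.
    exists (unbump k t); rewrite EAlow // unbumpK // inE.
    by apply: contraNneq nz => ->; rewrite tri.
  case: (boolP (nonzero_above A k u)) => [/nonzero_aboveP[s _ nz]|]; first by exists s.
  rewrite topA mem_old_cols // negb_or => /andP[ne_u].
  have lt_u : u < d by rewrite ltn_neqAle ne_u.
  rewrite lt_u /= /p /old_nonzero_above; case: (ltnP u k) => [lt_uk|le_ku] /negP H.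
    have [|s nz] := cols u; first by rewrite -/D Dd leqW.
    case: H; apply/nonzero_aboveP; exists s => //; rewrite ltnNge; apply/negP => le_ks.
    by rewrite tri ?(leq_trans lt_uk) in nz.
  have [|s nz] := cols u.+1; first by rewrite -/D Dd ltnS.
  case: (ltngtP s k) => [lt_s|lt_s|Es]; first by case: H; apply/nonzero_aboveP;
    exists s.
    exists s.-1; rewrite EAlow; last by rewrite -ltnS prednK ?(leq_ltn_trans _ lt_s).
    by rewrite prednK ?(leq_ltn_trans _ lt_s) // /bump le_ku.
  by move: nz; rewrite Es row_single Dd eqSS (ltn_eqF lt_u).
have topd : nonzero_above A k (tag A) by rewrite topA mem_old_cols // eqxx.
exists A => //; split; first exact: leqW.
have [Et Ee] := g_add3 (leq_mxidx fA topd) (le_kd : k <= tag A) topd.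
apply: sqmx_eq => [|s t le_s le_t]; first by rewrite Et -/D Dd.
rewrite Ee /add3_entry; case: ltnP => [lt_s|le_ks].
  rewrite (eq_old_cols le_kd Ep) (eq_new_cols le_kd Ep).
  rewrite (eq_transport UVsize (g := transport V U (entry B s))); last by move=> u _;
    apply: EAtop.
  by rewrite transportK // => u; rewrite VE; apply: nonzero_above0.
case: eqP => [->|/eqP ne_s]; first by rewrite row_single Dd.
have lt_s : k < s by rewrite ltn_neqAle eq_sym ne_s.
case: eqP => [->|/eqP ne_t]; first by rewrite tri.
rewrite EAlow; last by rewrite -ltnS prednK ?(leq_ltn_trans _ lt_s).
by rewrite prednK ?(leq_ltn_trans _ lt_s) // unbumpK.
Qed.

End Removal.

(** Which rule produced [B] is read off from the weight and the position of the
    row [k] that has the topmost nonzero cell of the last column. *)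
Lemma g_surj B : is_fishburn B -> 1 < mx_sum B ->
  exists A i, [/\ is_fishburn A, i <= (tag A).+1 & g A i = B].
Proof.
move=> fB gt1; have [k le_k [_ nz z]] := is_fishburn_last fB.
suff [A fA [le_i E]] :
  exists2 A, is_fishburn A & k <= (tag A).+1 /\ g A k = B by exists A, k.
case: (ltnP 1 (row_sum B k)) => [lt1|le1]; first exact: undo_add1.
have row1 : row_sum B k = 1 by apply/eqP; rewrite eqn_leq le1 row_sum_gt0.
case Dd: (tag B) => [|d].
  move: gt1; rewrite /mx_sum Dd big_seq1.
  by move: le_k; rewrite Dd leqn0 => /eqP Ek; rewrite -Ek row1.
case: (ltnP d k) => [lt_dk|le_kd]; last exact: (undo_add3 fB le_k nz z row1 Dd).
apply: (undo_add2 fB le_k nz z row1 Dd).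
by apply/eqP; rewrite eqn_leq le_k Dd.
Qed.

(** * The correspondence *)

(** A word [s] of length [n] and the matrix attached to it.  Besides the four
    statistics it has what the next insertion depends on: the number of active
    sites, the label of the site to the right of the largest entry, and the
    refinements of the two counts of maxima. *)
Record matches (n : nat) (s : seq nat) (A : sqmx) : Prop := Corr {
  matches_is_fishburn : is_fishburn A;
  matches_sum : mx_sum A = n;
  matches_dim : sites_after s = (tag A).+1;
  matches_mxidx : forall l r, s = l ++ n :: r -> mxidx A = (sites_after r).+1;
  matches_lr : forall j, LRmax_profile s j = entry A j (tag A);
  matches_rl_le : forall j, RLmax_profile s j <= 1;
  matches_rl : forall j, reflect (row_record (entry A) j) (RLmax_profile s j != 0);
  matches_rlmin : RLmin s = row_sum A 0;
  matches_lrmin : LRmin s = diag_count A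
}.

Lemma uniq_cat_cons_inj (x : nat) l r l' r' : uniq (l ++ x :: r) ->
  l ++ x :: r = l' ++ x :: r' -> l = l' /\ r = r'.
Proof.
move=> U E; have xl : x \notin l.
  by move: U; rewrite cat_uniq /= negb_or => /and3P[_ /andP[]].
have xl' : x \notin l'.
  by move: U; rewrite E cat_uniq /= negb_or => /and3P[_ /andP[]].
have Es : size l = size l'.
  have := congr1 (index x) E.
  by rewrite !index_cat (negPf xl) (negPf xl') /= eqxx !addn0.
by move/eqP: E; rewrite eqseq_cat // eqseq_cons => /and3P[/eqP-> _ /eqP->].
Qed.

Lemma sites_after_eq0 r : (sites_after r == 0) = (r == [::]).
Proof. by case: r => // a r; rewrite gtn_eqF ?sites_after_gt0. Qed.

(** [n] lies left of the insertion site exactly when the label is smaller than the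
    index, so the cases of the two recursions correspond. *)
Lemma matches_step n l r A : 0 < n -> l ++ r \in S_P n -> open_site l r ->
  matches n (l ++ r) A -> matches n.+1 (l ++ n.+1 :: r) (g A (sites_after r)).
Proof.
move=> n_gt0 lr_S lr_open [fA sumA dimA idxA lrA rl_leA rlA rlminA lrminA].
have le_i : sites_after r <= (tag A).+1 by rewrite -dimA leq_sites_after.
have nl : (n \in l) = (sites_after r < mxidx A).
  have : n \in l ++ r by rewrite (S_P_mem _ lr_S) n_gt0 leqnn.
  rewrite mem_cat; case: (boolP (n \in l)) => [nl _|_ nr]; apply/esym.
    case/splitPr: nl lr_S lr_open idxA => l1 l2 _ _ idxA.
    by rewrite (idxA l1 (l2 ++ r)) -?catA // ltnS leq_sites_after.
  case/splitPr: nr lr_S idxA {lr_open dimA lrA rl_leA rlA rlminA lrminA le_i} =>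
    r1 r2 lr_S idxA.
  rewrite (idxA (l ++ r1) r2) -?catA //; apply/negP; rewrite ltnS => H.
  have := leq_trans (leq_sites_after r1 (n :: r2)) H; rewrite sites_after_cons.
  suff -> : n.+1 \notin r2 by rewrite ltnn.
  apply/negP => h; have := S_P_mem n.+1 lr_S.
  by rewrite ltnn andbF !mem_cat inE h !orbT.
split.
- exact: g_is_fishburn.
- by rewrite g_mx_sum // sumA.
- by rewrite (@sites_after_insert_suffix n l r lr_S lr_open [::]) // dimA g_tag //
  nl -leqNgt addnC.
- move=> l' r' E; have [|_ <-] := uniq_cat_cons_inj _ E; last exact: g_mxidx.
  by have := S_P_insert lr_S; rewrite lr_open => /S_P_uniq.
- by move=> j; rewrite LRmax_profile_insert // g_lastcol // nl lrA; case: ifP => // _;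
    rewrite lrA.
- by move=> j; rewrite RLmax_profile_insert //; case: ifP => // _; apply: leq_b1.
- move=> j; rewrite RLmax_profile_insert //.
  apply: (iffP idP) => [H|/(g_record fA le_i)].
    by apply/(g_record fA le_i); move: H; case: ltnP => [_ /rlA //|_];
      rewrite eqb0 negbK => /eqP.
  case: (ltnP j (sites_after r)) => [_ H|_ ->]; last by rewrite eqxx.
  by apply/rlA.
- by rewrite RLmin_insert // g_row0 // rlminA sites_after_eq0.
rewrite LRmin_insert // g_diag_count // lrminA; congr (_ + nat_of_bool _).
rewrite -dimA; case: l lr_open {lr_S idxA lrA rl_leA rlA rlminA lrminA dimA nl} =>
  [|a l] lr_open.
  by rewrite /= !eqxx.
by rewrite ltn_eqF // (ltn_sites_after_open lr_open).
Qed.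

Definition one_mx : sqmx := Sqmx (const_mx 1 : 'M[nat]_1).

Lemma entry_one s t : entry one_mx s t = (s == 0) && (t == 0).
Proof.
rewrite /entry !leqn0; case: (s == 0) => //=; case: (t == 0) => //=.
by rewrite mxE.
Qed.

Lemma matches_one : matches 1 [:: 1] one_mx.
Proof.
have idx1 : mxidx one_mx = 1 by apply: mxidx_eq => //; rewrite entry_one.
split=> //.
- split=> [s t lt_ts|s|t].
  + by rewrite entry_one; case: s lt_ts.
  + by rewrite leqn0 => /eqP->; exists 0; rewrite entry_one.
  by rewrite leqn0 => /eqP->; exists 0; rewrite entry_one.
- by rewrite /mx_sum big_seq1 /row_sum big_seq1 entry_one.
- by move=> [|a [|b l]] r // [<-].
- by move=> j; rewrite entry_one /LRmax_profile /= addn0 eqSS eq_sym andbT.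
- by move=> j; rewrite /RLmax_profile /= addn0 leq_b1.
- move=> j; rewrite /RLmax_profile /= addn0 eqSS eqb0 negbK;
  apply: (iffP eqP) => [<-|[t]].
    by exists 0; rewrite ?entry_one.
  by rewrite entry_one; case: (j =P 0) => [->|].
- by rewrite row_sum_split big_nil entry_one.
by rewrite /diag_count /= entry_one.
Qed.

Lemma theta_insert n l r : 0 < n -> l ++ r \in S_P n -> open_site l r ->
  theta (l ++ n.+1 :: r) = rcons (theta (l ++ r)) (sites_after r).
Proof.
move=> n_gt0 lr_S lr_open; rewrite /theta (S_P_size lr_S).
have := S_P_insert lr_S; rewrite lr_open => lnr_S; rewrite (S_P_size lnr_S).
have nl : n.+1 \notin l.
  by have := S_P_mem n.+1 lr_S; rewrite ltnn andbF mem_cat => /negbT;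
    rewrite negb_or => /andP[].
have ind : index n.+1 (l ++ n.+1 :: r) = size l.
  by rewrite index_cat (negPf nl) /= eqxx addn0.
have rm : rem n.+1 (l ++ n.+1 :: r) = l ++ r.
  by rewrite remE ind take_size_cat // -cat_rcons drop_size_cat ?size_rcons.
case: n n_gt0 {lnr_S nl} lr_S ind rm => // n _ lr_S ind rm.
by rewrite [LHS]/= rm ind index_active_sites.
Qed.

Lemma phi_rcons x a : x != [::] -> phi (rcons x a) = g (phi x) a.
Proof. by case: x => // b x _; rewrite /phi /= foldl_rcons. Qed.

Lemma theta_nil n s : 0 < n -> s \in S_P n -> theta s != [::].
Proof.
move=> n_gt0 /S_P_size; rewrite /theta => ->; case: n n_gt0 => [//|[//|n]] _.
by rewrite /= -size_eq0 size_rcons.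
Qed.

Definition phi_theta (s : seq nat) : sqmx := phi (theta s).

Lemma phi_theta_insert n l r : 0 < n -> l ++ r \in S_P n -> open_site l r ->
  phi_theta (l ++ n.+1 :: r) = g (phi_theta (l ++ r)) (sites_after r).
Proof.
move=> n_gt0 lr_S lr_open; rewrite /phi_theta (theta_insert n_gt0) //.
by rewrite phi_rcons // (theta_nil n_gt0).
Qed.

Lemma S_P1 s : s \in S_P 1 -> s = [:: 1].
Proof.
case/andP=> perm_s _; have := perm_size perm_s; case: s perm_s => [|a [|b s]] //.
by move=> /perm_mem/(_ a); rewrite !inE eqxx => /esym/eqP->.
Qed.

(** Every avoider of positive length arises by inserting its largest entry into
    an active site of an avoider. *)
Variant S_P_split n : seq nat -> Prop :=
  SPSplit l r of l ++ r \in S_P n & open_site l r : S_P_split n (l ++ n.+1 :: r).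

Lemma S_P_splitP n s : s \in S_P n.+1 -> S_P_split n s.
Proof.
move=> s_S; have : n.+1 \in s by rewrite (S_P_mem _ s_S) leqnn.
move=> ns; case/splitPr: ns s_S => l r s_S; have lr_S := S_P_rem s_S.
by split=> //; rewrite -(S_P_insert lr_S).
Qed.

Lemma phi_theta_matches n s : s \in S_P n.+1 -> matches n.+1 s (phi_theta s).
Proof.
elim: n s => [|n IH] s s_S; first by rewrite (S_P1 s_S); apply: matches_one.
case/S_P_splitP: s_S => l r lr_S lr_open.
rewrite (phi_theta_insert (n := n.+1)) //; apply: matches_step => //.
exact: IH.
Qed.

(** Equal matrices come from equal smaller matrices and equal labels; the label
    determines the site. *)
Lemma phi_theta_inj n : {in S_P n.+1 &, injective phi_theta}.
Proof.
elim: n => [|n IH] s1 s2 s1_S s2_S; first by rewrite (S_P1 s1_S) (S_P1 s2_S).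
case/S_P_splitP: s1_S => l1 r1 S1 o1; case/S_P_splitP: s2_S => l2 r2 S2 o2.
rewrite !(phi_theta_insert (n := n.+1)) // => E.
have C1 := phi_theta_matches S1; have C2 := phi_theta_matches S2.
have [||||Es Er] := g_inj _ _ _ _ E.
- exact: matches_is_fishburn C1.
- exact: matches_is_fishburn C2.
- by rewrite -(matches_dim C1) leq_sites_after.
- by rewrite -(matches_dim C2) leq_sites_after.
have {}Es : l1 ++ r1 = l2 ++ r2 by apply: IH.
have I1 := index_active_sites S1 o1; have I2 := index_active_sites S2 o2.
have El : size l1 = size l2.
  rewrite Es in I1.
  have lt2 : sites_after r2 < size (active_sites n.+2 (l2 ++ r2)).
    by rewrite (size_active_sites S2) ltnS leq_sites_after.
  rewrite -(nth_index 0 (s := active_sites n.+2 (l2 ++ r2)) (x := size l1)).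
    by rewrite I1 Er -I2 nth_index // -index_mem I2.
  by rewrite -index_mem I1 Er.
by move/eqP: Es; rewrite eqseq_cat // => /andP[/eqP-> /eqP->].
Qed.

Lemma is_fishburn_one A : is_fishburn A -> mx_sum A = 1 -> A = one_mx.
Proof.
move=> fA sumA; have tagA : tag A = 0.
  case E: (tag A) => [|d] //; move: sumA; rewrite /mx_sum E.
  have -> : iota 0 d.+2 = [:: 0, 1 & iota 2 d] by [].
  rewrite !big_cons; have := @row_sum_gt0 A 0 fA; have := @row_sum_gt0 A 1 fA.
  by rewrite E => /(_ isT) h1 /(_ isT) h0; lia.
apply: sqmx_eq => // s t; rewrite tagA !leqn0 => /eqP-> /eqP->.
rewrite entry_one eqxx; move: sumA; rewrite /mx_sum /row_sum tagA.
by rewrite !big_cons !big_nil !addn0.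
Qed.

Lemma phi_theta_surj n B : is_fishburn B -> mx_sum B = n.+1 ->
  exists2 s, s \in S_P n.+1 & phi_theta s = B.
Proof.
elim: n B => [|n IH] B fB sumB; first by exists [:: 1];
  rewrite ?(is_fishburn_one fB sumB).
have [|A [i [fA le_i E]]] := g_surj fB; first by rewrite sumB.
have [|s s_S Es] := IH A fA.
  by apply: succn_inj; rewrite -(g_mx_sum fA le_i) E.
have lt_i : i < size (active_sites n.+2 s).
  by rewrite (size_active_sites s_S) ltnS (matches_dim (phi_theta_matches s_S)) Es.
pose k := nth 0 (active_sites n.+2 s) i.
have : k \in active_sites n.+2 s by apply: mem_nth.
rewrite mem_filter mem_rev mem_iota ltnS => /and3P[ins_S _ le_k].
have {}le_k : k <= size s by [].
have szk : size (take k s) = k by rewrite size_takel.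
have lr_S : take k s ++ drop k s \in S_P n.+1 by rewrite cat_take_drop.
have lr_open : open_site (take k s) (drop k s) by rewrite -(S_P_insert lr_S).
have Ei : sites_after (drop k s) = i.
  rewrite -(index_active_sites lr_S lr_open) szk cat_take_drop.
  by rewrite /k index_uniq // /active_sites filter_uniq // rev_uniq iota_uniq.
exists (insert_at k n.+2 s) => //.
by rewrite /insert_at (phi_theta_insert (n := n.+1)) // cat_take_drop Ei Es.
Qed.

(** * Weights, wNE-cells and the flip *)

Lemma sum_iota m (f : nat -> nat) : \sum_(t <- iota 0 m) f t = \sum_(t < m) f t.
Proof. by rewrite -(big_mkord xpredT) /index_iota subn0. Qed.

Lemma row_sumE A (i : 'I_(tag A).+1) : row_weight (tagged A) i = row_sum A i.
Proof.
rewrite /row_sum sum_iota.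
by apply: eq_bigr => j _; rewrite entry_ord.
Qed.

Lemma weightE A : weight (tagged A) = mx_sum A.
Proof.
rewrite /mx_sum sum_iota.
by apply: eq_bigr => i _; apply: row_sumE.
Qed.

Lemma mem_Mn n A : reflect (is_fishburn A /\ mx_sum A = n) (A \in Mn n).
Proof. by rewrite inE weightE; apply: (iffP andP) => -[/is_fishburnP fA /eqP sA]. Qed.

Lemma diag_countE A : num_diag (tagged A) = diag_count A.
Proof.
rewrite /num_diag /diag_count -val_enum_ord count_map cardE size_filter.
rewrite enumT; apply: eq_count => i.
by rewrite /= inE entry_ord.
Qed.

(** The wNE-cell of a row, if any, is its last nonzero cell. *)
Lemma num_wNE_records A (b : pred nat) :
  (forall j, reflect (row_record (entry A) j) (b j)) ->
  num_wNE (tagged A) = \sum_(j < (tag A).+1) b j.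
Proof.
move=> bP; have E : [set j : 'I_(tag A).+1 | b j] =
    [set c.1 | c in [set c : 'I_(tag A).+1 * 'I_(tag A).+1 | wNE (tagged A) c.1 c.2]].
  apply/setP => j; rewrite inE; apply/bP/imsetP => [[t nz z]|[[i t]]].
    have ex : exists t, entry A j t != 0 by exists t.
    have ub t' : entry A j t' != 0 -> t' <= tag A by move=> nz';
      have /andP[] := entry_bound nz'.
    case: (ex_maxnP ex ub) => m nzm max_m.
    have le_m := ub m nzm; have lt_m : m < (tag A).+1 by [].
    exists (j, Ordinal lt_m) => //; rewrite inE /wNE -entry_ord nzm /=.
    apply/forallP => s; apply/forallP => t'; apply/implyP => /and3P[le_s le_t ne].
    rewrite -entry_ord; move: le_s; rewrite leq_eqVlt => /orP[/eqP Es|lt_s].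
      apply: contraNT ne => nz'; have := max_m t'; rewrite -Es => /(_ nz') le_t'.
      by rewrite xpair_eqE -!val_eqE /= Es eqxx eqn_leq le_t' le_t.
    by rewrite z // (leq_trans _ le_t) // max_m.
  rewrite inE /= => /andP[nz /forallP z] ->; exists t; first by rewrite entry_ord.
  move=> s t' lt_si le_t; case: (leqP t' (tag A)) => [le_t'|lt_t']; last first.
    by rewrite entry_out ?lt_t' ?orbT.
  have lt_s : s < (tag A).+1 by apply: ltn_trans (ltn_ord i).
  have lt_t' : t' < (tag A).+1 by [].
  have := forallP (z (Ordinal lt_s)) (Ordinal lt_t').
  rewrite -entry_ord xpair_eqE -val_eqE /= (ltnW lt_si) le_t (ltn_eqF lt_si) /=.
  by move/eqP.
rewrite /num_wNE -(card_in_imset (f := fst)) -?E.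
  by rewrite -sum1dep_card big_mkcond; apply: eq_bigr => j _; case: (b j).
move=> [i t] [i' t']; rewrite !inE /= => /andP[nz /forallP z] /andP[nz' /forallP z'] Ei.
rewrite -Ei in nz' z' *; congr (_, _); apply/eqP/negPn/negP => ne.
case/orP: (leq_total t t') => le_t.
  have := forallP (z i) t'; rewrite leqnn le_t xpair_eqE eqxx eq_sym ne /=.
  by rewrite (negPf nz').
have := forallP (z' i) t; rewrite leqnn le_t xpair_eqE eqxx ne /=.
by rewrite (negPf nz).
Qed.

Lemma flipK : involutive flip.
Proof.
case=> d M; rewrite /flip /Sqmx; congr existT; apply/matrixP => i j.
by rewrite !mxE !rev_ordK.
Qed.

Lemma entry_flip A s t : s <= tag A -> t <= tag A ->
  entry (flip A) s t = entry A (tag A - t) (tag A - s).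
Proof.
case: A => d M; apply: (@entry_ext (flip (existT _ d M))
   (fun s t => entry (existT _ d M) (d - t) (d - s))) => /= i j; rewrite mxE.
by rewrite -(entry_ord (A := Sqmx M)) /= !subSS.
Qed.

Lemma tag_flip A : tag (flip A) = tag A. Proof. by case: A. Qed.

Lemma flip_is_fishburn A : is_fishburn A -> is_fishburn (flip A).
Proof.
case=> tri rows cols; split=> [s t lt_ts|s|t]; rewrite ?tag_flip.
- case: (leqP s (tag A)) => [le_s|lt_s]; last by rewrite entry_out // tag_flip lt_s.
  have le_t := ltnW (leq_trans lt_ts le_s).
  by rewrite entry_flip // tri // ltn_sub2l // (leq_trans lt_ts).
- move=> le_s; have [u nz] := cols _ (leq_subr s (tag A)).
  have /andP[le_u _] := entry_bound nz.
  by exists (tag A - u); rewrite entry_flip ?leq_subr // subKn.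
move=> le_t; have [u nz] := rows _ (leq_subr t (tag A)).
have /andP[_ le_u] := entry_bound nz.
by exists (tag A - u); rewrite entry_flip ?leq_subr // subKn.
Qed.

Lemma flip_mx_sum A : mx_sum (flip A) = mx_sum A.
Proof.
rewrite -!weightE; case: A => d M; rewrite /weight /= exchange_big /=.
rewrite [RHS](reindex_inj rev_ord_inj); apply: eq_bigr => i _ /=.
by rewrite [RHS](reindex_inj rev_ord_inj); apply: eq_bigr => j _ /=; rewrite mxE.
Qed.

Lemma flip_row0 A : row_weight (tagged (flip A)) ord0 = \sum_(j < (tag A).+1) entry A
  j (tag A).
Proof.
case: A => d M; rewrite /row_weight /= (reindex_inj rev_ord_inj).
apply: eq_bigr => i _; rewrite mxE rev_ordK -(entry_ord (A := Sqmx M)) /=.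
by rewrite subn1.
Qed.

Lemma flip_last_col A : col_weight (tagged (flip A)) ord_max = row_sum A 0.
Proof.
rewrite -(row_sumE (A := A) ord0); case: A => d M; rewrite /col_weight /row_weight /=.
rewrite (reindex_inj rev_ord_inj); apply: eq_bigr => i _; rewrite mxE rev_ordK.
by congr (M _ _); apply: val_inj; rewrite /= subnn.
Qed.

Lemma flip_diag A : num_diag (tagged (flip A)) = num_diag (tagged A).
Proof.
case: A => d M; rewrite /num_diag /= -[RHS](card_imset _ rev_ord_inj).
apply: eq_card => i; rewrite -[i in RHS]rev_ordK (mem_imset _ _ rev_ord_inj).
by rewrite !inE mxE.
Qed.

Lemma flip_wNE A : num_wNE (tagged (flip A)) = num_wNE (tagged A).
Proof.
case: A => d M; rewrite /num_wNE /=;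
  pose f (c : 'I_d.+1 * 'I_d.+1) := (rev_ord c.2, rev_ord c.1).
have fK : involutive f by case=> i j; rewrite /f /= !rev_ordK.
have f_inj := inv_inj fK.
rewrite -[RHS](card_imset _ f_inj); apply: eq_card => c.
rewrite -[c in RHS]fK (mem_imset _ _ f_inj) !inE /wNE mxE; congr (_ && _).
have le_rev (x y : 'I_d.+1) : (rev_ord x <= rev_ord y) = (y <= x).
  by rewrite /= leq_sub2lE // ltnS.
have E s t :
    ([&& rev_ord t <= rev_ord c.2, rev_ord c.1 <= rev_ord s
       & (rev_ord t, rev_ord s) != (rev_ord c.2, rev_ord c.1)]
     ==> (M (rev_ord t) (rev_ord s) == 0)) =
    ([&& s <= c.1, c.2 <= t & (s, t) != (c.1, c.2)]
     ==> ((\matrix_(i, j) M (rev_ord j) (rev_ord i))%R s t == 0)).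
  rewrite mxE !le_rev !xpair_eqE !(inj_eq rev_ord_inj) andbCA.
  by rewrite [(t == _) && _]andbC.
apply/forallP/forallP => z s; apply/forallP => t.
  by have := forallP (z (rev_ord t)) (rev_ord s); rewrite -E !rev_ordK.
by rewrite -E; apply: (forallP (z (rev_ord t)) (rev_ord s)).
Qed.

Theorem theorem3p8 (n : nat) (hn : 1 <= n) :
  [/\ {in S_P n, forall pi, alpha pi \in Mn n},
      {in S_P n &, injective alpha}
    & {in Mn n, forall A, exists2 pi, pi \in S_P n & alpha pi = A}] /\
  (forall pi : seq nat, pi \in S_P n ->
    [/\ LRmax pi = row_weight (tagged (alpha pi)) ord0,
        RLmin pi = col_weight (tagged (alpha pi)) ord_max,
        RLmax pi = num_wNE (tagged (alpha pi))
      & LRmin pi = num_diag (tagged (alpha pi))]).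
Proof.
case: n hn => // n _; split; first split.
- move=> s /phi_theta_matches [fA sumA _ _ _ _ _ _ _]; apply/mem_Mn.
  by split; [apply: flip_is_fishburn | rewrite flip_mx_sum].
- by move=> s1 s2 S1 S2 /(inv_inj flipK) E; apply: (phi_theta_inj S1 S2 E).
- move=> A /mem_Mn[fA sumA].
  have [||s s_S Es] := @phi_theta_surj n (flip A); first exact: flip_is_fishburn.
    by rewrite flip_mx_sum.
  by exists s => //; rewrite -[A]flipK -Es.
move=> s /phi_theta_matches [_ _ dimA _ lrA rl_le rlA rlminA lrminA].
rewrite -[alpha s]/(flip (phi_theta s)).
rewrite flip_row0 flip_last_col flip_wNE flip_diag diag_countE; split=> //.
  by rewrite -sum_LRmax_profile dimA; apply: eq_bigr => j _; apply: lrA.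
rewrite (num_wNE_records rlA) -sum_RLmax_profile dimA; apply: eq_bigr => j _.
by have := rl_le j; case: (RLmax_profile s j) => [|[|m]].
Qed.
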